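(* Let $$\alpha=1+\sum_{i=1}^\infty\frac{\log_2 h_{2^i-1}}{2^i}=1.637\ldots$$ Let $R_n$ be the largest size of a rooted ordered binary tree that is the ordered shape of at least two distinct clades of $\mathrm{DTCS}(n)$, and let $R_n^u$ be the largest size of a rooted unordered binary tree that is the unordered shape of at least two distinct clades of $\mathrm{DTCS}(n)$. Then, with high probability as $n\to\infty$, $$R_n\in\left[\left(\tfrac1\alpha-o(1)\right)\log_2 n,\ \left(\tfrac2\alpha+o(1)\right)\log_2 n\right]$$ and $$R_n^u\in\left[\left(\tfrac1\alpha-o(1)\right)\log_2 n,\ \left(\tfrac{2}{\alpha-1}+o(1)\right)\log_2 n\right].$$
   Context: Binary trees are rooted full binary trees: every internal vertex has exactly two children. The size of a tree is its number of leaves. Ordered trees (plane trees) are trees in which the left and right subtrees of each internal vertex are distinguished; $T=T'$ means identical as rooted ordered trees, and $T\cong T'$ means identical as rooted unordered trees. For $m\ge 2$ let $h_{m-1}=\sum_{j=1}^{m-1}1/j$ and let $q_m$ be the probability distribution on $\{1,\dots,m-1\}$ given by $$q_m(i)=\frac{m}{2h_{m-1}}\,\frac{1}{i(m-i)}.$$ The discrete-time critical beta-splitting tree $\mathrm{DTCS}(n)$ is the random rooted ordered binary tree with $n$ leaves built as follows: split $[n]=\{1,\dots,n\}$ into a left subtree on $\{1,\dots,L_n\}$ and a right subtree on $\{L_n+1,\dots,n\}$, where $L_n$ has distribution $q_n$; then recursively and independently split each interval of size $m\ge2$ into left and right parts according to $q_m$, stopping at intervals of size $m=1$ (the leaves).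 Leaf labels are disregarded when comparing shapes. A clade (fringe subtree) of a rooted tree is the subtree induced by an internal vertex together with all of its descendants; clades rooted at different internal vertices are distinct. The ordered shape of a clade is its isomorphism class as a rooted ordered tree, and its unordered shape is its isomorphism class as a rooted unordered tree. $\log_2$ is the base-two logarithm. ''With high probability'' means with probability tending to $1$ as $n\to\infty$; the statement $X_n\in[(a-o(1))f(n),(b+o(1))f(n)]$ with high probability means that for every $\varepsilon>0$, $\mathbb{P}\big((a-\varepsilon)f(n)\le X_n\le(b+\varepsilon)f(n)\big)\to1$. *)

(* Defs.v *)
From HB Require Import structures.
From mathcomp Require Import all_boot all_order all_algebra.
From mathcomp Require Import all_classical all_reals all_analysis.
Import Order.TTheory GRing.Theory Num.Theory.
Import numFieldNormedType.Exports.

Set Implicit Arguments.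
Unset Strict Implicit.
Unset Printing Implicit Defensive.

Local Open Scope ring_scope.

(* Rooted ordered full binary trees, without labels. *)
Inductive bintree : Type := Leaf | Node of bintree & bintree.

Fixpoint bintree_eqb (s t : bintree) : bool :=
  match s, t with
  | Leaf, Leaf => true
  | Node s1 s2, Node t1 t2 => bintree_eqb s1 t1 && bintree_eqb s2 t2
  | _, _ => false
  end.

Lemma bintree_eqbP : Equality.axiom bintree_eqb.
Proof.
elim=> [|s1 IH1 s2 IH2] [|t1 t2] /=; try by constructor.
by apply: (iffP andP) => [[/IH1 -> /IH2 ->]|[/IH1 ? /IH2 ?]].
Qed.

HB.instance Definition _ := hasDecEq.Build bintree bintree_eqbP.

Fixpoint leaves (t : bintree) : nat :=
  if t is Node l r then (leaves l + leaves r)%N else 1%N.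

(* Identity as rooted unordered trees. *)
Fixpoint unordered_iso (s t : bintree) : bool :=
  match s, t with
  | Leaf, Leaf => true
  | Node s1 s2, Node t1 t2 =>
      (unordered_iso s1 t1 && unordered_iso s2 t2) ||
      (unordered_iso s1 t2 && unordered_iso s2 t1)
  | _, _ => false
  end.

(* One entry per internal vertex, so that clades rooted at different internal
   vertices are counted separately even when they have the same shape. *)
Fixpoint clades (t : bintree) : seq bintree :=
  if t is Node l r then t :: clades l ++ clades r else [::].

(* A shape shared by two clades of t is the shape of an element of clades t, so
   it is enough to take the maximum over clades t.  The value is 0 when no shape
   is repeated. *)
Definition largest_repeat (same_shape : rel bintree) (t : bintree) : nat :=
  \max_(s <- clades t | (2 <= count (same_shape s) (clades t))%N) leaves s.

Definition R_ord : bintree -> nat := largest_repeat eq_op.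

Definition R_unord : bintree -> nat := largest_repeat unordered_iso.

(* Finitely supported distributions, as lists of (weight, outcome) pairs; an
   outcome may be listed several times, and its weights then add up. *)
Section FiniteDistributions.
Context {R : realType}.

Definition fdist (T : Type) : Type := seq (R * T).

Definition fret {T : Type} (x : T) : fdist T := [:: (1, x)].

Definition fbind {T U : Type} (d : fdist T) (f : T -> fdist U) : fdist U :=
  flatten [seq [seq (w.1 * v.1, v.2) | v <- f w.2] | w <- d].

Definition Pr {T : Type} (d : fdist T) (E : pred T) : R :=
  \sum_(w <- d | E w.2) w.1.

Lemma Pr_fret T (x : T) E : Pr (fret x) E = (E x)%:R.
Proof. by rewrite /Pr big_cons big_nil /=; case: (E x); rewrite ?addr0. Qed.

Lemma Pr_fbind T U (d : fdist T) (f : T -> fdist U) E :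
  Pr (fbind d f) E = \sum_(w <- d) w.1 * Pr (f w.2) E.
Proof.
rewrite /Pr big_flatten big_map; apply: eq_bigr => w _.
by rewrite big_map mulr_sumr.
Qed.

End FiniteDistributions.

Arguments fdist : clear implicits.

Section BetaSplitting.
Context {R : realType}.

Definition harm (k : nat) : R := \sum_(1 <= j < k.+1) j%:R^-1.

Definition log2 (x : R) : R := ln x / ln 2%:R.

Definition split_prob (m i : nat) : R :=
  m%:R / (2%:R * harm m.-1) * (i%:R * (m - i)%:R)^-1.

Definition split_dist (m : nat) : fdist R nat :=
  [seq (split_prob m i, i) | i <- index_iota 1 m].

(* The recursion splits an interval of size m into intervals of sizes i and
   m - i, which are both smaller than m; fuel >= m is enough for it to reach
   the leaves. *)
Fixpoint dtcs_rec (fuel m : nat) : fdist R bintree :=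
  if fuel is k.+1 then
    if (m <= 1)%N then fret Leaf else
    fbind (split_dist m) (fun i =>
    fbind (dtcs_rec k i) (fun l =>
    fbind (dtcs_rec k (m - i)) (fun r =>
    fret (Node l r))))
  else fret Leaf.

(* For n = 0, which has no meaning here, this is the one-leaf tree. *)
Definition dtcs (n : nat) : fdist R bintree := dtcs_rec n n.

Lemma dtcs_recE k m : (m <= k)%N -> dtcs_rec k m = dtcs m.
Proof.
elim/ltn_ind: m k => m IH k mk; rewrite /dtcs.
case: k m mk IH => [|k] [|m] // mk IH /=.
case: ltnP => // m0; rewrite /fbind /split_dist.
congr flatten; rewrite -!map_comp; apply/eq_in_map => i /=.
rewrite mem_index_iota => /andP[i1 im].
have jm : (m.+1 - i <= m)%N by rewrite leq_subLR -add1n leq_add2r.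
have im' : (i <= m)%N by rewrite -ltnS.
by rewrite !(IH i)// ?(leq_trans im')// !(IH (m.+1 - i)%N)// (leq_trans jm).
Qed.

Lemma dtcs1 : dtcs 1 = fret Leaf.
Proof. by []. Qed.

Lemma dtcsE m : (2 <= m)%N ->
  dtcs m = fbind (split_dist m) (fun i =>
           fbind (dtcs i) (fun l =>
           fbind (dtcs (m - i)) (fun r => fret (Node l r)))).
Proof.
case: m => // m m2; rewrite [LHS]/dtcs /= ltnNge -ltnS m2 /=.
rewrite /fbind /split_dist.
congr flatten; rewrite -!map_comp; apply/eq_in_map => i /=.
rewrite mem_index_iota => /andP[i1 im].
by rewrite !dtcs_recE// leq_subLR -add1n leq_add2r.
Qed.

Definition alpha : R :=
  1 + limn (fun N : nat =>
        \sum_(1 <= i < N) log2 (harm (2 ^ i - 1)) / 2%:R ^+ i).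

(* X lies in [(a - o(1)) log2 n, (b + o(1)) log2 n] with high probability when
   it is evaluated at the random tree DTCS(n). *)
Definition whp_log2_between (X : bintree -> nat) (a b : R) : Prop :=
  forall eps : R, 0 < eps ->
  (Pr (dtcs n) (fun t => (a - eps) * log2 n%:R <= (X t)%:R
                           <= (b + eps) * log2 n%:R)
     @[n --> \oo] --> (1 : R))%classic.

End BetaSplitting.

Arguments alpha : clear implicits.

Lemma harm_gt0 (R : realType) k : (0 < k)%N -> 0 < harm k :> R.
Proof.
case: k => // k _; rewrite /harm big_nat_recl//= invr1.
by rewrite ltr_pwDl// sumr_ge0// => i _; rewrite invr_ge0 ler0n.
Qed.

Lemma Pr_split_distT (R : realType) m : (2 <= m)%N ->
  Pr (split_dist m : fdist R nat) predT = 1.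
Proof.
move=> m2; rewrite /Pr /split_dist big_map /=.
have h0 : harm m.-1 != 0 :> R by rewrite gt_eqF// harm_gt0// -ltnS prednK// ltnW.
have m0 : m%:R != 0 :> R by rewrite pnatr_eq0 -lt0n ltnW.
rewrite -mulr_sumr.
suff -> : \sum_(1 <= i < m) (i%:R * (m - i)%:R)^-1 = 2%:R * harm m.-1 / m%:R :> R.
  by rewrite mulrA mulfVK ?divff// mulf_neq0// pnatr_eq0.
have E (i : nat) : (1 <= i < m)%N ->
    (i%:R * (m - i)%:R)^-1 = (i%:R^-1 + (m - i)%:R^-1) / m%:R :> R.
  move=> /andP[i1 im].
  have ei : i%:R != 0 :> R by rewrite pnatr_eq0 -lt0n.
  have ej : (m - i)%:R != 0 :> R by rewrite pnatr_eq0 -lt0n subn_gt0.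
  have em : m%:R = (m - i)%:R + i%:R :> R by rewrite -natrD subnK// ltnW.
  apply: (mulIf m0); rewrite divfK// em mulrDr.
  by rewrite invfM -mulrA mulVf// mulr1 mulrAC mulVf// mul1r.
rewrite (eq_big_nat _ _ E) -mulr_suml big_split /=; congr (_ / _).
rewrite [X in _ + X]big_nat_rev /=.
rewrite [X in _ + X](_ : _ = \sum_(1 <= i < m) i%:R^-1); last first.
  by apply: eq_big_nat => i /andP[i1 im]; rewrite add1n subSS subKn// ltnW.
by rewrite -mulr2n -[LHS]mulr_natl /harm prednK// ltnW.
Qed.

Lemma Pr_dtcsT (R : realType) n : Pr (dtcs n : fdist R bintree) predT = 1.
Proof.
elim/ltn_ind: n => -[|[|n]] IH; rewrite ?Pr_fret//.
have PrTE (T : Type) (d : fdist R T) : Pr d predT = \sum_(w <- d) w.1 by [].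
rewrite dtcsE// Pr_fbind -(@Pr_split_distT R n.+2)// PrTE [RHS]big_map big_map.
apply: eq_big_nat => i /andP[i1 im] /=; rewrite -[RHS]mulr1; congr (_ * _).
rewrite Pr_fbind -(IH i)// PrTE; apply: eq_bigr => -[w l] _ /=.
rewrite -[RHS]mulr1; congr (_ * _).
rewrite Pr_fbind -(IH (n.+2 - i)%N); last by rewrite ltn_subrL i1.
by rewrite PrTE; apply: eq_bigr => -[v r] _ /=; rewrite Pr_fret mulr1.
Qed.

(* Main.v *)
(* Weights telescope: an ordered tree t of size m is the shape of DTCS(m) with
   probability m / (2 ^ (m - 1) * prod_v h_(m_v - 1)), where v runs over the
   internal vertices and m_v is the size of the clade at v.  Since k |-> h_k is
   increasing and concave, balanced splits minimise the product, and
   log2 prod_v h_(m_v - 1) >= (alpha - 1) m - O(log m), with equality up to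
   O(log ^ 2 m) for the tree read off the binary expansion of m.  Hence the
   likeliest ordered shape has probability 2 ^ (- alpha m + o(m)); an unordered
   shape gains a factor at most 2 per vertex.

   Upper bounds: two disjoint clades are independent given their sizes, so the
   expected number of pairs of equal clades of size at least k is at most n ^ 2
   times the largest probability of a shape of size at least k.

   Lower bound: fix a likeliest tree s of size m, of probability p, and cut
   DTCS(n) into its maximal clades of size at most M = m ^ 2.  The mass of the
   pieces smaller than m is at most n / m in expectation, so at least n / (2 M)
   pieces have size at least m with probability 1 - O(1 / m); they are
   independent and each contains s with probability at least p / (2 M ^ 2).
   When m = (1 / alpha - eps) log2 n this produces two copies of s. *)

Require Import Defs.
From Stdlib Require Import NArith.
From mathcomp Require Import all_boot all_order all_algebra.
From mathcomp Require Import all_classical all_reals all_analysis.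
From mathcomp Require Import ring lra zify.
Import Order.TTheory GRing.Theory Num.Theory.
Import numFieldNormedType.Exports.

Set Implicit Arguments.
Unset Strict Implicit.
Unset Printing Implicit Defensive.

Local Open Scope ring_scope.

(** * Expectations of functions of a random tree *)

Section Expectation.
Context {R : realType}.

Definition Ex {T : Type} (d : fdist R T) (f : T -> R) : R :=
  \sum_(w <- d) w.1 * f w.2.

Lemma Ex_fret T (x : T) f : Ex (fret x) f = f x.
Proof. by rewrite /Ex big_seq1 mul1r. Qed.

Lemma Ex_fbind T U (d : fdist R T) (k : T -> fdist R U) f :
  Ex (fbind d k) f = Ex d (fun x => Ex (k x) f).
Proof.
rewrite /Ex big_flatten big_map; apply: eq_bigr => w _.
by rewrite big_map mulr_sumr; apply: eq_bigr => v _; rewrite mulrA.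
Qed.

Lemma PrE T (d : fdist R T) (P : pred T) : Pr d P = Ex d (fun x => (P x)%:R).
Proof.
rewrite /Pr /Ex big_mkcond; apply: eq_bigr => w _.
by case: (P w.2); rewrite ?mulr1 ?mulr0.
Qed.

Definition Etree n (f : bintree -> R) : R := Ex (dtcs n) f.

Lemma Etree1 f : Etree 1 f = f Leaf.
Proof. by rewrite /Etree dtcs1 Ex_fret. Qed.

Lemma EtreeS n f : (2 <= n)%N ->
  Etree n f = \sum_(1 <= i < n)
     split_prob n i * Etree i (fun l => Etree (n - i) (fun r => f (Node l r))).
Proof.
move=> n2; rewrite /Etree dtcsE// Ex_fbind {1}/Ex big_map.
apply: eq_bigr => i _ /=; rewrite Ex_fbind; congr (_ * _).
apply: eq_bigr => -[w l] _ /=; congr (_ * _).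
by rewrite Ex_fbind; apply: eq_bigr => -[v r] _ /=; rewrite Ex_fret.
Qed.

Lemma harm_ge0 k : 0 <= harm k :> R.
Proof. by rewrite sumr_ge0// => i _; rewrite invr_ge0 ler0n. Qed.

Lemma split_prob_ge0 m i : 0 <= split_prob m i :> R.
Proof.
by rewrite mulr_ge0 ?divr_ge0 ?invr_ge0 ?mulr_ge0 ?ler0n ?harm_ge0.
Qed.

Lemma sum_split_prob n : (2 <= n)%N ->
  \sum_(1 <= i < n) split_prob n i = 1 :> R.
Proof. by move=> /(Pr_split_distT R); rewrite /Pr big_map. Qed.

(** The split weights form a probability distribution, so a bound valid for every split survives
    averaging; several inductions on the size below conclude this way. *)
Lemma split_average_le n (f : nat -> R) c : (2 <= n)%N ->
  (forall i, (1 <= i < n)%N -> f i <= c) ->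
  \sum_(1 <= i < n) split_prob n i * f i <= c.
Proof.
move=> n2 fc; apply: (@le_trans _ _ (\sum_(1 <= i < n) split_prob n i * c)).
  by apply: ler_sum_nat => i /fc; apply: ler_wpM2l; exact: split_prob_ge0.
by rewrite -mulr_suml sum_split_prob// mul1r.
Qed.

Lemma split_probC n i : (1 <= i < n)%N ->
  split_prob n (n - i) = split_prob n i :> R.
Proof.
move=> /andP[_ /ltnW lein]; rewrite /split_prob; congr (_ * _^-1).
by rewrite mulrC subKn.
Qed.

Lemma Etree_cst n c : Etree n (fun=> c) = c.
Proof.
rewrite /Etree /Ex -mulr_suml -[RHS]mul1r; congr (_ * _).
exact: Pr_dtcsT.
Qed.

Lemma Etree0 n : Etree n (fun=> 0) = 0.
Proof. exact: Etree_cst. Qed.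

Lemma EtreeD n f g : Etree n (fun t => f t + g t) = Etree n f + Etree n g.
Proof. by rewrite /Etree /Ex -big_split; apply: eq_bigr => w _; rewrite mulrDr. Qed.

Lemma EtreeZ n c f : Etree n (fun t => c * f t) = c * Etree n f.
Proof. by rewrite /Etree /Ex mulr_sumr; apply: eq_bigr => w _; rewrite mulrCA. Qed.

Lemma EtreeZr n c f : Etree n (fun t => f t * c) = Etree n f * c.
Proof. by rewrite mulrC -EtreeZ; apply: eq_bigr => w _; rewrite [c * _]mulrC. Qed.

Lemma Etree_sum (I : Type) n (r : seq I) (P : pred I) (F : I -> bintree -> R) :
  Etree n (fun t => \sum_(i <- r | P i) F i t) =
  \sum_(i <- r | P i) Etree n (F i).
Proof.
rewrite /Etree /Ex exchange_big; apply: eq_bigr => w _ /=.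
by rewrite mulr_sumr.
Qed.

(** The weights are nonnegative and [dtcs n] yields only trees with [n] leaves; following the
    recursion avoids describing its support. Size 0 is excluded because [dtcs 0] is a one-leaf
    tree. *)
Lemma le_Etree n f g : (0 < n)%N ->
  (forall t, leaves t = n -> f t <= g t) -> Etree n f <= Etree n g.
Proof.
elim/ltn_ind: n f g => -[|[|n]] IH f g // _ fg; first by rewrite !Etree1 fg.
rewrite !EtreeS// ler_sum_nat// => i /andP[i1 iltn].
apply: ler_wpM2l; first exact: split_prob_ge0.
apply: (IH i) => // l ll; apply: (IH (n.+2 - i)%N); rewrite ?subn_gt0 ?ltn_subrL ?i1//.
by move=> r rr; apply: fg; rewrite /= ll rr subnKC// ltnW.
Qed.

Lemma eq_Etree n f g : (0 < n)%N ->
  (forall t, leaves t = n -> f t = g t) -> Etree n f = Etree n g.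
Proof.
by move=> n0 fg; apply/eqP; rewrite eq_le !le_Etree// => t /fg ->.
Qed.

Lemma Etree_ge0 n f : (0 < n)%N -> (forall t, leaves t = n -> 0 <= f t) ->
  0 <= Etree n f.
Proof. by move=> n0 f0; rewrite -(Etree0 n) le_Etree. Qed.

Lemma Pr_dtcsE n P : Pr (dtcs n) P = Etree n (fun t => (P t)%:R).
Proof. exact: PrE. Qed.

(** Given the split sizes, the two subtrees are independent. *)
Lemma EtreeS_mul n (f : bintree -> R) g1 g2 : (2 <= n)%N ->
  (forall l r, (leaves l + leaves r)%N = n -> f (Node l r) = g1 l * g2 r) ->
  Etree n f = \sum_(1 <= i < n) split_prob n i * (Etree i g1 * Etree (n - i) g2).
Proof.
move=> n2 fE; rewrite EtreeS//; apply: eq_big_nat => i /andP[i1 iltn].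
congr (_ * _); rewrite -EtreeZr; apply: eq_Etree => // l li.
rewrite -EtreeZ; apply: eq_Etree => [|r ri]; first by rewrite subn_gt0.
by rewrite fE// li ri subnKC// ltnW.
Qed.

Lemma EtreeS_add n (f : bintree -> R) g : (2 <= n)%N ->
  (forall l r, (leaves l + leaves r)%N = n -> f (Node l r) = g l + g r) ->
  Etree n f = \sum_(1 <= i < n) split_prob n i * (Etree i g + Etree (n - i) g).
Proof.
move=> n2 fE; rewrite EtreeS//; apply: eq_big_nat => i /andP[i1 iltn].
congr (_ * _); transitivity (Etree i (fun l => g l + Etree (n - i) g)).
  apply: eq_Etree => // l li; rewrite -[g l in RHS](Etree_cst (n - i)) -EtreeD.
  apply: eq_Etree => [|r ri]; first by rewrite subn_gt0.
  by rewrite fE// li ri subnKC// ltnW.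
by rewrite EtreeD Etree_cst.
Qed.

End Expectation.

Lemma leaves_gt0 t : (0 < leaves t)%N.
Proof. by elim: t => //= l l0 r _; rewrite addn_gt0 l0. Qed.

(** Proper clades of [t] are smaller than [s], so only the root can match. Equality may fail at
    [Leaf], which has no clade. *)
Lemma count_clades_small (S : rel bintree) s t :
  (forall s t, S s t -> leaves s = leaves t) ->
  (leaves t <= leaves s)%N -> (count (S s) (clades t) <= S s t)%N.
Proof.
move=> SE; elim: t => //= l IHl r IHr lers.
have := leaves_gt0 l; have := leaves_gt0 r => r0 l0.
have small u : (leaves u < leaves s)%N -> S s u = false.
  by move=> us; apply/negP => /SE su; rewrite su ltnn in us.
have ll : (leaves l < leaves s)%N by apply: leq_trans lers; rewrite -addn1 leq_add2l.
have lr : (leaves r < leaves s)%N by apply: leq_trans lers; rewrite -add1n leq_add2r.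
have := IHl (ltnW ll); have := IHr (ltnW lr); rewrite (small l)// (small r)//.
by rewrite !leqn0 count_cat => /eqP-> /eqP->; rewrite !addn0.
Qed.

(** * Harmonic numbers and the constant alpha *)

Section HarmonicNumbers.
Context {R : realType}.
Local Notation harm := (@harm R).

Lemma harm0 : harm 0 = 0.
Proof. by rewrite /harm big_geq. Qed.

Lemma harmS k : harm k.+1 = harm k + k.+1%:R^-1.
Proof. by rewrite /harm big_nat_recr. Qed.

Lemma le_harm k l : (k <= l)%N -> harm k <= harm l.
Proof.
elim: l => [|l IH]; first by rewrite leqn0 => /eqP->.
rewrite leq_eqVlt => /predU1P[->//|/IH/le_trans->//].
by rewrite harmS lerDl invr_ge0.
Qed.

Lemma harm_ge1 k : (0 < k)%N -> 1 <= harm k.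
Proof. by move/le_harm; rewrite harmS harm0 add0r invr1. Qed.

Lemma harm_leS k : harm k.+1 <= harm k + 1.
Proof. by rewrite harmS lerD2l invf_le1// ler1n. Qed.

Lemma harm_le k : harm k <= k%:R.
Proof.
elim: k => [|k IH]; first by rewrite harm0.
by rewrite (le_trans (harm_leS k))// -natr1 lerD2r.
Qed.

(** When [d] grows by one, the right side gains the increment after [a + d] twice; the left side
    gains two later increments, which are no larger. *)
Lemma harm_concave a d :
  harm a + harm (a + d.*2) <= 2 * harm (a + d).
Proof.
elim: d => [|d IH]; first by rewrite addn0 mulr2n mulrDl !mul1r.
rewrite doubleS !addnS !harmS.
have inv_le (i j : nat) : (i <= j)%N -> j.+1%:R^-1 <= i.+1%:R^-1 :> R.
  by move=> ij; rewrite lef_pV2 ?posrE// ler_nat.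
have I1 : (a + d.*2).+1%:R^-1 <= (a + d).+1%:R^-1 :> R by apply: inv_le; lia.
have I2 : (a + d.*2).+2%:R^-1 <= (a + d).+1%:R^-1 :> R by apply: inv_le; lia.
by move: IH I1 I2; set u := _^-1; set v := _^-1; set w := _^-1; lra.
Qed.

Lemma harm_midpoint a b c : (0 < a)%N -> (0 < b)%N -> (a + b = c.*2)%N ->
  harm a.-1 + harm b.-1 <= 2 * harm c.-1.
Proof.
wlog leab : a b / (a <= b)%N.
  move=> H a0 b0 abc; case: (leqP a b) => [/H|/ltnW/H]; first exact.
  by rewrite addrC; apply=> //; rewrite addnC.
move=> a0 b0 abc.
have cE : c.-1 = (a.-1 + (c - a))%N by lia.
have bE : b.-1 = (a.-1 + (c - a).*2)%N by lia.
by rewrite cE bE harm_concave.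
Qed.

Lemma log2M (x y : R) : 0 < x -> 0 < y -> log2 (x * y) = log2 x + log2 y.
Proof. by move=> x0 y0; rewrite /log2 lnM ?posrE// mulrDl. Qed.

Lemma ln2_gt0 : 0 < ln 2 :> R.
Proof. by rewrite ln_gt0// ltr1n. Qed.

Lemma ler_log2 (x y : R) : 0 < x -> x <= y -> log2 x <= log2 y.
Proof.
move=> x0 xy; rewrite /log2 ler_wpM2r ?invr_ge0 ?(ltW ln2_gt0)//.
by rewrite ler_ln ?posrE// (lt_le_trans x0).
Qed.

Lemma log2_ge0 (x : R) : 1 <= x -> 0 <= log2 x.
Proof. by move=> x1; apply: divr_ge0; [exact: ln_ge0|exact: ltW ln2_gt0]. Qed.

Lemma log2X (x : R) n : 0 < x -> log2 (x ^+ n) = n%:R * log2 x.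
Proof. by move=> x0; rewrite /log2 lnXn// mulr_natl mulrnAl. Qed.

Lemma log2V (x : R) : 0 < x -> log2 x^-1 = - log2 x.
Proof. by move=> x0; rewrite /log2 lnV ?posrE// mulNr. Qed.

Lemma log22 : log2 2 = 1 :> R.
Proof. by rewrite /log2 divff// gt_eqF// ln2_gt0. Qed.

Lemma log2_2X n : log2 (2 ^+ n) = n%:R :> R.
Proof. by rewrite log2X// log22 mulr1. Qed.

Definition node_cost (m : nat) : R := log2 (harm m.-1).

Lemma node_cost_ge0 m : (2 <= m)%N -> 0 <= node_cost m.
Proof. by case: m => [|[|m]] // _; rewrite log2_ge0// harm_ge1. Qed.

Lemma node_cost_concave a b c : (2 <= a)%N -> (2 <= b)%N ->
  (a + b = c.*2)%N -> node_cost a + node_cost b <= 2 * node_cost c.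
Proof.
move=> a2 b2 abc.
have [ha hb hc] : [/\ 0 < harm a.-1, 0 < harm b.-1 & 0 < harm c.-1].
  by split; apply: harm_gt0; lia.
rewrite /node_cost -log2M// -log2X//; apply: ler_log2; first exact: mulr_gt0.
have := @harm_midpoint a b c (ltnW a2) (ltnW b2) abc.
move: ha hb hc; set x := harm _; set y := harm _; set z := harm _ => x0 y0 z0 h.
(* AM-GM passes midpoint concavity from [harm] to its logarithm. *)
have : x * y <= ((x + y) / 2) ^+ 2.
  by rewrite -subr_ge0; have := sqr_ge0 ((x - y) / 2); lra.
move=> /le_trans -> //; rewrite lerXn2r ?nnegrE//; lra.
Qed.

Lemma node_cost_le m k : (2 <= m)%N -> (m <= 2 ^ k)%N -> node_cost m <= k%:R.
Proof.
move=> m2 mk; rewrite -log2_2X; apply: ler_log2; first by apply: harm_gt0; lia.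
by rewrite (le_trans (harm_le _))// -natrX ler_nat; lia.
Qed.

(* With c = balanced_defect N, concavity of node_cost gives
   c a + c b <= node_cost (a + b) + c (a + b), with equality (for N = oo) at
   a = b; so m * c 1 - c m bounds from below the cost of a tree of size m, and
   c 1 tends to alpha - 1. *)
Definition balanced_defect (N m : nat) : R :=
  \sum_(1 <= j < N) node_cost (2 ^ j * m) / 2 ^+ j.

Lemma balanced_defect_step N a b : (0 < a)%N -> (0 < b)%N ->
  balanced_defect N a + balanced_defect N b <=
  node_cost (a + b) + balanced_defect N (a + b).
Proof.
move=> a0 b0.
have c0 : 0 <= node_cost (a + b) by apply: node_cost_ge0; lia.
case: N => [|N]; first by rewrite /balanced_defect !big_geq// !addr0.
(* The midpoint of 2^j a and 2^j b is 2^(j-1) (a + b). After the shift of index, the term 0 is the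
   node cost itself. *)
apply: (@le_trans _ _ (\sum_(1 <= j < N.+1) node_cost (2 ^ j.-1 * (a + b)) / 2 ^+ j.-1)).
  rewrite -big_split /=; apply: ler_sum_nat => -[//|j] _ /=.
  rewrite -mulrDl exprS ler_pdivrMr ?mulr_gt0 ?exprn_gt0//.
  rewrite [2 * 2 ^+ j]mulrC mulrA divfK ?expf_neq0// mulrC.
  have j0 : (0 < 2 ^ j)%N by rewrite expn_gt0.
  by apply: node_cost_concave; rewrite ?expnS; nia.
rewrite big_add1 /=.
apply: (@le_trans _ _ (\sum_(0 <= j < N.+1) node_cost (2 ^ j * (a + b)) / 2 ^+ j)).
  rewrite [leRHS]big_nat_recr//= lerDl divr_ge0 ?exprn_ge0//.
  have N0 : (0 < 2 ^ N)%N by rewrite expn_gt0.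
  by apply: node_cost_ge0; nia.
by rewrite big_ltn// mul1n expr0 divr1.
Qed.

Lemma sum_linear_pow2 (N : nat) (L : R) : (0 < N)%N ->
  \sum_(1 <= j < N) (j%:R + L) / 2 ^+ j = L + 2 - (N%:R + 1 + L) / 2 ^+ N.-1.
Proof.
elim: N => // -[|N] IH _; first by rewrite big_geq// expr0 divr1; lra.
rewrite big_nat_recr//= IH// exprS.
by rewrite -!natr1; field; rewrite expf_neq0.
Qed.

(** From h_k <= k, the j-th cost is at most j + log2 m; the sums of j / 2^j and 1 / 2^j are at most
    2 and 1. This bounds the series for [alpha] and is the logarithmic error in [log2_hprod_ge]. *)
Lemma balanced_defect_le N m : (0 < m)%N ->
  balanced_defect N m <= log2 m%:R + 2.
Proof.
move=> m0; have l0 : 0 <= log2 m%:R :> R by rewrite log2_ge0// ler1n.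
case: N => [|N]; first by rewrite /balanced_defect big_geq// addr_ge0.
apply: (@le_trans _ _ (\sum_(1 <= j < N.+1) (j%:R + log2 m%:R) / 2 ^+ j)).
  apply: ler_sum_nat => j /andP[j1 _].
  rewrite ler_pM2r ?invr_gt0 ?exprn_gt0// -log2_2X -log2M ?exprn_gt0 ?ltr0n//.
  have jm : (2 <= 2 ^ j * m)%N.
    case: j j1 => // j _; rewrite expnS.
    by have : (0 < 2 ^ j)%N; [rewrite expn_gt0|nia].
  apply: ler_log2; first by apply: harm_gt0; lia.
  by rewrite -natrX -natrM (le_trans (harm_le _))// ler_nat leq_pred.
rewrite sum_linear_pow2// lerBlDr lerDl divr_ge0 ?exprn_ge0//.
by rewrite !addr_ge0// ler0n.
Qed.

Lemma alphaE : alpha R = 1 + limn (fun N => balanced_defect N 1).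
Proof.
rewrite /alpha; congr (1 + _); congr (limn _); apply/funext => N.
by apply: eq_bigr => j _; rewrite /node_cost muln1 subn1.
Qed.

Lemma balanced_defect_homo m : (0 < m)%N ->
  {homo (fun N => balanced_defect N m) : N M / (N <= M)%N >-> N <= M}.
Proof.
move=> m0; apply: homo_leq => [//|x y z|N]; first exact: le_trans.
case: N => [|N]; first by rewrite /balanced_defect !big_geq.
rewrite /balanced_defect [leRHS]big_nat_recr//= lerDl divr_ge0 ?exprn_ge0//.
have N0 : (0 < 2 ^ N)%N by rewrite expn_gt0.
by apply: node_cost_ge0; rewrite expnS; nia.
Qed.

(** [limn] takes a default value on divergent sequences, so convergence precedes any comparison of
    the truncations with [alpha]. *)
Lemma cvg_balanced_defect1 : cvgn (fun N => balanced_defect N 1).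
Proof.
apply: nondecreasing_is_cvgn; first exact: balanced_defect_homo.
by exists (log2 1%:R + 2) => _ [N _ <-]; apply: balanced_defect_le.
Qed.

Lemma balanced_defect1_le N : balanced_defect N 1 <= alpha R - 1.
Proof.
rewrite alphaE addrC addKr.
apply: nondecreasing_cvgn_le cvg_balanced_defect1 N.
exact: balanced_defect_homo.
Qed.

Lemma alpha_le (c : R) : (forall N, balanced_defect N 1 <= c) -> alpha R - 1 <= c.
Proof.
move=> le_c; rewrite alphaE addrC addKr; apply: limr_le.
  exact: cvg_balanced_defect1.
by apply: nearW.
Qed.

End HarmonicNumbers.

(** * Probabilities of shapes *)

Section ShapeProbability.
Context {R : realType}.
Local Notation harm := (@harm R).
Local Notation E := (@Etree R).

Fixpoint hprod (t : bintree) : R :=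
  if t is Node l r then
    harm (leaves l + leaves r).-1 * hprod l * hprod r else 1.

Lemma hprod_gt0 t : 0 < hprod t.
Proof.
elim: t => //= l l0 r r0; rewrite !mulr_gt0// harm_gt0//.
by have := leaves_gt0 l; have := leaves_gt0 r; lia.
Qed.

Lemma log2_hprod_Node l r : log2 (hprod (Node l r)) =
  node_cost (leaves (Node l r)) + log2 (hprod l) + log2 (hprod r).
Proof.
have h0 : 0 < harm (leaves l + leaves r).-1.
  by apply: harm_gt0; have := leaves_gt0 l; have := leaves_gt0 r; lia.
by rewrite /= !log2M ?mulr_gt0 ?hprod_gt0.
Qed.

(** Induction on the tree, with [balanced_defect_step] at each vertex. Truncation keeps limits out
    of the induction; [alpha_le] removes it afterwards. *)
Lemma log2_hprod_ge_trunc N t :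
  (leaves t)%:R * balanced_defect N 1 - balanced_defect N (leaves t)
    <= log2 (hprod t).
Proof.
elim: t => [|l IHl r IHr]; first by rewrite /= mul1r subrr log2_ge0.
have := @balanced_defect_step R N _ _ (leaves_gt0 l) (leaves_gt0 r).
by rewrite log2_hprod_Node /= natrD; move: IHl IHr; lra.
Qed.

Lemma log2_hprod_ge t :
  (leaves t)%:R * (alpha R - 1) <= log2 (hprod t) + (log2 (leaves t)%:R + 2).
Proof.
have m0 : 0 < (leaves t)%:R :> R by rewrite ltr0n leaves_gt0.
rewrite mulrC -ler_pdivlMr//; apply: alpha_le => N; rewrite ler_pdivlMr// mulrC.
have := log2_hprod_ge_trunc N t; have := @balanced_defect_le R N _ (leaves_gt0 t).
lra.
Qed.

Lemma expR_ln2M (x : R) : 0 < x -> expR (ln 2 * log2 x) = x.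
Proof.
by move=> x0; rewrite /log2 mulrCA divff ?mulr1 ?lnK// gt_eqF// ln2_gt0.
Qed.

Lemma hprod_inv_le t :
  (hprod t)^-1 <= 4 * (leaves t)%:R * expR (- ((alpha R - 1) * ln 2) * (leaves t)%:R).
Proof.
have t0 := hprod_gt0 t; have m0 : 0 < (leaves t)%:R :> R by rewrite ltr0n leaves_gt0.
have -> : 4 * (leaves t)%:R * expR (- ((alpha R - 1) * ln 2) * (leaves t)%:R) =
   expR (ln 2 * (2 + log2 (leaves t)%:R - (leaves t)%:R * (alpha R - 1))).
  rewrite mulrBr mulrDr expRB expRD expR_ln2M// -expRN.
  have -> : ln 2 * 2 = ln 2 * log2 (2 ^+ 2) :> R by rewrite log2_2X.
  rewrite expR_ln2M ?exprn_gt0// -natrX; congr (_ * expR _).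
  by ring.
rewrite -[leLHS]expR_ln2M ?invr_gt0// ler_expR ler_wpM2l ?(ltW ln2_gt0)//.
rewrite log2V//.
by have := log2_hprod_ge t; lra.
Qed.

Lemma Etree_shape_neq (S : rel bintree) s n : (0 < n)%N -> n != leaves s ->
  (forall s t, S s t -> leaves s = leaves t) ->
  E n (fun t => (S s t)%:R) = 0.
Proof.
move=> n0 /negP ns SE; rewrite -(Etree0 n); apply: eq_Etree => // t tn.
by case: (boolP (S s t)) => // /SE; rewrite tn => e; case: ns; apply/eqP.
Qed.

(** [S] preserves sizes, so a single split size contributes. *)
Lemma EtreeS_shapes (S : rel bintree) s1 s2 f :
  (forall s t, S s t -> leaves s = leaves t) ->
  (forall l r, f (Node l r) = (S s1 l)%:R * (S s2 r)%:R) ->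
  E (leaves s1 + leaves s2) f =
  split_prob (leaves s1 + leaves s2) (leaves s1) *
  (E (leaves s1) (fun t => (S s1 t)%:R) * E (leaves s2) (fun t => (S s2 t)%:R)).
Proof.
move=> SE fE; have l1 := leaves_gt0 s1; have l2 := leaves_gt0 s2.
rewrite (EtreeS_mul (g1 := fun t => (S s1 t)%:R) (g2 := fun t => (S s2 t)%:R)) //;
  last by rewrite -[2%N]/(1 + 1)%N leq_add.
rewrite (bigD1_seq (leaves s1)) ?iota_uniq//=; last first.
  by rewrite mem_index_iota l1 -[X in (X < _)%N]addn0 ltn_add2l.
rewrite addnC addnK big1_seq ?addr0// => i /andP[is1]; rewrite mem_index_iota => /andP[i1 _].
by rewrite (Etree_shape_neq _ is1)// mul0r mulr0.
Qed.

Lemma eq_op_leaves (s t : bintree) : s == t -> leaves s = leaves t.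
Proof. by move/eqP->. Qed.

Lemma unordered_iso_leaves s t : unordered_iso s t -> leaves s = leaves t.
Proof.
elim: s t => [|s1 IH1 s2 IH2] [|t1 t2] //= /orP[]/andP[/IH1-> /IH2->] //.
exact: addnC.
Qed.

Lemma unordered_iso_refl t : unordered_iso t t.
Proof. by elim: t => //= l -> r ->. Qed.

(** The factor 1 / (i (m - i)) in [split_prob] cancels the numerators coming from the two subtrees,
    so each vertex leaves only 1 / (2 h). *)
Lemma Pr_shape s : E (leaves s) (fun t => (s == t)%:R) =
  (leaves s)%:R / (2 ^+ (leaves s).-1 * hprod s).
Proof.
elim: s => [|s1 IH1 s2 IH2]; first by rewrite Etree1 /= expr0 mulr1 divr1.
rewrite (EtreeS_shapes (S := eq_op) eq_op_leaves); last first.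
  by move=> l r; rewrite -natrM mulnb.
rewrite IH1 IH2 /= /split_prob addnC addnK.
have := leaves_gt0 s1; have := leaves_gt0 s2.
case: (leaves s1) => // a; case: (leaves s2) => // b _ _.
rewrite addSn addnS /=.
have h0 : harm (b + a).+1 != 0 by rewrite gt_eqF// harm_gt0.
have := hprod_gt0 s1; have := hprod_gt0 s2 => /lt0r_neq0 n2 /lt0r_neq0 n1.
rewrite [in RHS]addnC exprS exprD.
have [-> ->] : a.+1%:R = a%:R + 1 :> R /\ b.+1%:R = b%:R + 1 :> R by rewrite !natr1.
have a0 : a%:R + 1 != 0 :> R by rewrite natr1 pnatr_eq0.
have b0 : b%:R + 1 != 0 :> R by rewrite natr1 pnatr_eq0.
have p0 k : 2 ^+ k != 0 :> R by rewrite expf_neq0// pnatr_eq0.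
rewrite addnC in h0 *; field.
by rewrite h0 n1 n2 b0 a0 !p0.
Qed.

(** The two orders of the children contribute equally, which cancels the 2 in the denominator of
    [split_prob]; the power of 2 of [Pr_shape] disappears. *)
Lemma Pr_unordered_shape s :
  E (leaves s) (fun t => (unordered_iso s t)%:R) <= (leaves s)%:R / hprod s.
Proof.
elim: s => [|s1 IH1 s2 IH2]; first by rewrite Etree1 /= divr1.
have SE := unordered_iso_leaves.
pose f t : R := if t is Node l r then
  (unordered_iso s1 l)%:R * (unordered_iso s2 r)%:R else 0.
pose g t : R := if t is Node l r then
  (unordered_iso s2 l)%:R * (unordered_iso s1 r)%:R else 0.
apply: (@le_trans _ _ (E (leaves (Node s1 s2)) (fun t => f t + g t))).
  apply: le_Etree => [|[|l r] _]; rewrite ?leaves_gt0//= ?addr0//.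
  by case: (unordered_iso s1 l) (unordered_iso s2 l)
    (unordered_iso s1 r) (unordered_iso s2 r) => -[] [] [] //=; lra.
have Eg : E (leaves s1 + leaves s2) g = split_prob (leaves s1 + leaves s2) (leaves s1) *
    (E (leaves s2) (fun t => (unordered_iso s2 t)%:R) *
     E (leaves s1) (fun t => (unordered_iso s1 t)%:R)).
  rewrite addnC (@EtreeS_shapes unordered_iso _ _ g)// -split_probC ?addKn//.
  by have := leaves_gt0 s1; have := leaves_gt0 s2; lia.
rewrite EtreeD /= (@EtreeS_shapes unordered_iso _ _ f)// Eg -mulrDr.
set u1 := E _ _ in IH1 *; set u2 := E _ _ in IH2 *.
have a1 := leaves_gt0 s1; have b1 := leaves_gt0 s2.
have u10 : 0 <= u1 by apply: Etree_ge0.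
have u20 : 0 <= u2 by apply: Etree_ge0.
rewrite [u2 * u1]mulrC -mulr2n.
apply: (@le_trans _ _ (split_prob (leaves s1 + leaves s2) (leaves s1) *
   (((leaves s1)%:R / hprod s1) * ((leaves s2)%:R / hprod s2) *+ 2))).
  rewrite ler_wpM2l ?split_prob_ge0// lerMn2r/=; exact: ler_pM.
rewrite /split_prob addnC addnK.
have h0 : harm (leaves s2 + leaves s1).-1 != 0 by rewrite gt_eqF// harm_gt0//; lia.
have := hprod_gt0 s1; have := hprod_gt0 s2 => /lt0r_neq0 n2 /lt0r_neq0 n1.
rewrite addnC in h0 *; rewrite le_eqVlt; apply/orP; left; apply/eqP.
rewrite [in RHS]/=.
have a0 : (leaves s1)%:R != 0 :> R by rewrite pnatr_eq0 -lt0n.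
have b0 : (leaves s2)%:R != 0 :> R by rewrite pnatr_eq0 -lt0n.
rewrite natrD; field.
by rewrite h0 n1 n2 b0 a0.
Qed.

Lemma Pr_shape_le s : E (leaves s) (fun t => (s == t)%:R) <=
  8 * (leaves s)%:R ^+ 2 * expR (- (alpha R * ln 2) * (leaves s)%:R).
Proof.
rewrite Pr_shape invfM mulrCA.
have -> : - (alpha R * ln 2) * (leaves s)%:R =
   - (ln 2 * (leaves s)%:R) - ((alpha R - 1) * ln 2) * (leaves s)%:R by ring.
rewrite expRD expRN; have := leaves_gt0 s; move: (hprod_inv_le s).
case: (leaves s) => // m; set X := expR _; set u := _^-1 => uX _.
rewrite [m.+1.-1]/= -[X in expR (ln 2 * X)](@log2_2X R m.+1) expR_ln2M ?exprn_gt0//.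
rewrite [2 ^+ m.+1]exprS -mulNr -/X (_ : 8 * _ * _ = (2 ^+ m)^-1 * (m.+1%:R * (4 * m.+1%:R * X))).
  by rewrite ler_wpM2l ?invr_ge0 ?exprn_ge0// ler_wpM2l.
by field; rewrite expf_neq0.
Qed.

Lemma Pr_unordered_shape_le s :
  E (leaves s) (fun t => (unordered_iso s t)%:R) <=
  4 * (leaves s)%:R ^+ 2 * expR (- ((alpha R - 1) * ln 2) * (leaves s)%:R).
Proof.
apply: (le_trans (Pr_unordered_shape s)).
set X := expR _.
have -> : 4 * (leaves s)%:R ^+ 2 * X = (leaves s)%:R * (4 * (leaves s)%:R * X).
  by ring.
by rewrite ler_wpM2l// hprod_inv_le.
Qed.

(** * Shapes of nearly minimal cost *)

Fixpoint perfect k : bintree :=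
  if k is k'.+1 then Node (perfect k') (perfect k') else Leaf.

Lemma leaves_perfect k : leaves (perfect k) = (2 ^ k)%N.
Proof. by elim: k => //= k ->; rewrite expnS mul2n addnn. Qed.

(** There are 2^(k-j) vertices of size 2^j, so the cost is a rescaled partial sum of the series for
    [alpha]. *)
Lemma log2_hprod_perfect k :
  log2 (hprod (perfect k)) = 2 ^+ k * balanced_defect k.+1 1.
Proof.
elim: k => [|k IH].
  by rewrite /= /balanced_defect big_geq// mulr0 /log2 ln1 mul0r.
rewrite log2_hprod_Node [leaves _]/= leaves_perfect IH.
rewrite addnn -mul2n -expnS -[X in node_cost X]muln1.
rewrite [in RHS]/balanced_defect big_nat_recr//= -/(balanced_defect k.+1 1).
rewrite mulrDr mulrCA divff ?expf_neq0// mulr1 exprS.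
by ring.
Qed.

(** Peel off the leading binary digit of [m]: a perfect tree is joined to a light tree for the
    remaining digits. The joins add fewer than [k] vertices, each of cost at most [k]. *)
Lemma light_tree k m : (0 < m < 2 ^ k)%N -> exists2 t, leaves t = m &
  log2 (hprod t) <= m%:R * (alpha R - 1) + k%:R ^+ 2.
Proof.
elim: k m => [[|[]]//|k IH] m /andP[m0 mk].
have [mltk|lekm] := ltnP m (2 ^ k)%N.
  have [|t tm tle] := IH m; first by rewrite m0.
  by exists t => //; apply: (le_trans tle); rewrite lerD2l lerXn2r ?nnegrE// ler_nat.
have pk : log2 (hprod (perfect k)) <= 2 ^+ k * (alpha R - 1).
  by rewrite log2_hprod_perfect ler_wpM2l ?exprn_ge0// balanced_defect1_le.
have [mE|mneq] := eqVneq m (2 ^ k)%N.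
  exists (perfect k); rewrite ?leaves_perfect// (le_trans pk)// mE natrX lerDl.
  exact: exprn_ge0.
have [|t tm tle] := IH (m - 2 ^ k)%N.
  by move: mk; rewrite expnS; move: mneq lekm => /eqP; lia.
exists (Node (perfect k) t); first by rewrite /= leaves_perfect tm subnKC.
rewrite log2_hprod_Node [leaves _]/= leaves_perfect tm subnKC//.
have k0 : (0 < 2 ^ k)%N by rewrite expn_gt0.
(* The new vertex costs at most k + 1, which fits in (k + 1)^2 - k^2. *)
have := @node_cost_le R m k.+1 _ (ltnW mk).
move: mneq lekm => /eqP mneq lekm.
have m2 : (2 <= m)%N by lia.
move=> /(_ m2); move: tle pk; rewrite natrB// natrX.
have -> : k.+1%:R = k%:R + 1 :> R by rewrite natr1.
have : 0 <= k%:R :> R by rewrite ler0n.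
set a := node_cost _; set b := log2 _; set c := log2 _; set p := 2 ^+ k.
lra.
Qed.

End ShapeProbability.

(** * Upper bounds on repeated clades *)

Section UpperBound.
Context {R : realType}.
Local Notation E := (@Etree R).
Variables (S : rel bintree).
Hypothesis leavesS : forall s t, S s t -> leaves s = leaves t.

Definition has_repeat (k : nat) (t : bintree) : bool :=
  has (fun s => (k <= leaves s) && (2 <= count (S s) (clades t)))%N (clades t).

Definition cross_repeats (k : nat) (l r : bintree) : nat :=
  \sum_(s <- clades l | (k <= leaves s)%N) count (S s) (clades r).

(** At [k = 0] this would fail: the maximum is 0 when no shape is repeated. *)
Lemma largest_repeat_ge k t : (0 < k)%N ->
  (k <= largest_repeat S t)%N -> has_repeat k t.
Proof.
move=> k0; apply: contraTT => /hasPn nr; rewrite -ltnNge -[k in ltnRHS]prednK//.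
rewrite ltnS; apply/bigmax_leqP_seq => s st s2.
by rewrite -ltnS prednK//; have := nr _ st; rewrite s2 andbT -ltnNge.
Qed.

Lemma leaves_clades s t : s \in clades t -> (leaves s <= leaves t)%N.
Proof.
elim: t => //= l IHl r IHr; rewrite inE mem_cat => /orP[/eqP->//|/orP[/IHl|/IHr]] /leq_trans;
  by apply; rewrite /= ?leq_addr ?leq_addl.
Qed.

Lemma size_clades t : size (clades t) = (leaves t).-1.
Proof.
elim: t => //= l IHl r IHr; rewrite size_cat IHl IHr.
by have := leaves_gt0 l; have := leaves_gt0 r; lia.
Qed.

Lemma cross_repeats_gt0 k s l r : (k <= leaves s)%N -> s \in clades l ->
  (0 < count (S s) (clades r))%N -> (0 < cross_repeats k l r)%N.
Proof.
move=> ks sl c0; apply: leq_trans c0 _; rewrite /cross_repeats.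
by rewrite (big_rem s)//= ks leq_addr.
Qed.

(** The root is larger than every other clade, so a repeat lies within one child or across the two.
    Both directions across occur because [S] may be asymmetric. *)
Lemma has_repeat_Node k l r : has_repeat k (Node l r) ->
  [|| has_repeat k l, has_repeat k r, 0 < cross_repeats k l r |
      0 < cross_repeats k r l]%N.
Proof.
have l0 := leaves_gt0 l; have r0 := leaves_gt0 r.
move=> /hasP[s]; rewrite inE => sl /andP[ks] /=; rewrite count_cat.
case/predU1P: sl => [->|].
  have cl := @count_clades_small S (Node l r) l leavesS (leq_addr _ _).
  have cr := @count_clades_small S (Node l r) r leavesS (leq_addl _ _).
  have Nl : S (Node l r) l = false by apply/negP => /leavesS /=; lia.
  have Nr : S (Node l r) r = false by apply/negP => /leavesS /=; lia.
  by move: cl cr; rewrite Nl Nr !leqn0 => /eqP-> /eqP->; case: (S _ _).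
rewrite mem_cat => slr.
have sltlr : (leaves s < leaves l + leaves r)%N.
  by case/orP: slr => /leaves_clades; lia.
have -> : S s (Node l r) = false by apply/negP => /leavesS /=; lia.
rewrite add0n => c2; case/orP: slr => [sl|sr].
- have [c0|] := ltnP 0 (count (S s) (clades r)).
    by rewrite (cross_repeats_gt0 ks sl c0) !orbT.
  rewrite leqn0 => /eqP c0; rewrite c0 addn0 in c2.
  by apply/orP; left; apply/hasP; exists s; rewrite ?ks.
- have [c0|] := ltnP 0 (count (S s) (clades l)).
    by rewrite (cross_repeats_gt0 ks sr c0) !orbT.
  rewrite leqn0 => /eqP c0; rewrite c0 add0n in c2.
  by apply/orP; right; apply/orP; left; apply/hasP; exists s; rewrite ?ks.
Qed.

Section FixedSize.
Variables (k : nat) (p : R).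
Hypothesis shape_le : forall s, (k <= leaves s)%N ->
  E (leaves s) (fun t => (S s t)%:R) <= p.

(** A bound linear in [n] is additive over the two children; when [n] is at most the size of [s],
    only the root can match. *)
Lemma Etree_count_le s n : (k <= leaves s)%N -> (0 < n)%N ->
  E n (fun t => (count (S s) (clades t))%:R) <= n%:R * p.
Proof.
move=> ks; have p0 : 0 <= p.
  by apply: le_trans (shape_le ks); apply: Etree_ge0; rewrite ?leaves_gt0.
elim/ltn_ind: n => n IH n0.
have [nles|sltn] := leqP n (leaves s).
  apply: (@le_trans _ _ (E n (fun t => (S s t)%:R))).
    by apply: le_Etree => // t tn; rewrite ler_nat count_clades_small// tn.
  have [->|ns] := eqVneq n (leaves s).
    apply: (le_trans (shape_le ks)); rewrite -[leLHS]mul1r ler_wpM2r//.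
    by rewrite ler1n leaves_gt0.
  by rewrite (@Etree_shape_neq R S s)// mulr_ge0.
have n2 : (2 <= n)%N by have := leaves_gt0 s; lia.
rewrite (EtreeS_add (g := fun t => (count (S s) (clades t))%:R)) //; last first.
  move=> l r lr /=; rewrite count_cat.
  have -> : S s (Node l r) = false by apply/negP => /leavesS /=; lia.
  by rewrite add0n natrD.
apply: split_average_le => // i /andP[i1 iltn].
have -> : n%:R * p = i%:R * p + (n - i)%:R * p.
  by rewrite -mulrDl -natrD subnKC// ltnW.
by rewrite lerD// IH//; lia.
Qed.

(** Fix [l]: it has at most i - 1 clades, and each is matched at most j * p times on average in the
    independent other subtree. *)
Lemma Etree_cross_le i j : (0 < k)%N -> (0 < i)%N -> (0 < j)%N ->
  E i (fun l => E j (fun r => (cross_repeats k l r)%:R)) <= i%:R * j%:R * p.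
Proof.
move=> k0 i0 j0.
have p0 : 0 <= p.
  (* [perfect k] serves as a shape of size at least [k], which forces [p] to be nonnegative. *)
  have kp : (k <= leaves (perfect k))%N by rewrite leaves_perfect ltnW// ltn_expl.
  by apply: le_trans (shape_le kp); apply: Etree_ge0; rewrite ?leaves_gt0.
rewrite -[leRHS](Etree_cst i); apply: le_Etree => // l li.
rewrite (@eq_Etree _ j _ (fun r => \sum_(s <- clades l | (k <= leaves s)%N)
    (count (S s) (clades r))%:R)) => [|//|r _]; last by rewrite -natr_sum.
rewrite Etree_sum.
apply: (@le_trans _ _ (\sum_(s <- clades l | (k <= leaves s)%N) j%:R * p)).
  by apply: ler_sum => s ks; exact: Etree_count_le.
rewrite big_const_seq iter_addr_0 -[_ * p *+ _]mulr_natl -mulrA ler_wpM2r ?mulr_ge0// ler_nat.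
by rewrite (leq_trans (count_size _ _))// size_clades li leq_pred.
Qed.

(** Repeats inside the children and the two cross terms add up to i^2 + j^2 + 2 i j = n^2 times
    [p]. *)
Lemma Pr_has_repeat_le n : (0 < k)%N -> (0 < n)%N ->
  E n (fun t => (has_repeat k t)%:R) <= n%:R ^+ 2 * p.
Proof.
move=> k0; have p0 : 0 <= p.
  have kp : (k <= leaves (perfect k))%N by rewrite leaves_perfect ltnW// ltn_expl.
  by apply: le_trans (shape_le kp); apply: Etree_ge0; rewrite ?leaves_gt0.
elim/ltn_ind: n => n IH n0.
have [n1|n2] := leqP n 1.
  have -> : n = 1%N by lia.
  by rewrite Etree1 /= expr1n mul1r.
rewrite EtreeS//.
apply: split_average_le => // i /andP[i1 iltn].
have j0 : (0 < n - i)%N by lia.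
pose h t : R := (has_repeat k t)%:R.
pose c l r : R := (cross_repeats k l r)%:R.
apply: (@le_trans _ _ (E i (fun l => h l + E (n - i) h +
    (E (n - i) (c l) + E (n - i) (fun r => c r l))))).
  apply: le_Etree => // l li.
  rewrite -[h l](Etree_cst (n - i)) -!EtreeD; apply: le_Etree => // r ri.
  have := @has_repeat_Node k l r; rewrite /h /c.
  case: has_repeat => [/(_ isT)|_]; last by rewrite !addr_ge0.
  have ge1 (m : nat) : (0 < m)%N -> 1 <= m%:R :> R by rewrite ler1n.
  case/or4P => [->|->|/ge1|/ge1]; rewrite /=.
  - by rewrite -[leLHS]addr0 -addrA lerD2l !addr_ge0.
  - by rewrite [_%:R + 1]addrC -[leLHS]addr0 -addrA lerD2l !addr_ge0.
  - by move=> /le_trans; apply; rewrite addrCA lerDl !addr_ge0.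
  - by move=> /le_trans; apply; rewrite addrA lerDr !addr_ge0.
rewrite !EtreeD Etree_cst.
(* Exchanging the finite sums puts the other child outside, as [Etree_cross_le] requires. *)
have swap : E i (fun l => E (n - i) (fun r => c r l)) =
    E (n - i) (fun r => E i (c r)).
  rewrite /Etree /Ex; under eq_bigr do rewrite mulr_sumr.
  rewrite exchange_big; apply: eq_bigr => w _ /=.
  by rewrite mulr_sumr; apply: eq_bigr => v _; rewrite mulrCA.
rewrite swap; have -> : n%:R = i%:R + (n - i)%:R :> R.
  by rewrite -natrD subnKC// ltnW.
have := IH i iltn i1; have := IH (n - i)%N _ j0; rewrite ltn_subrL i1 n0 => /(_ isT).
have := @Etree_cross_le i (n - i) k0 i1 j0.
have := @Etree_cross_le (n - i) i k0 j0 i1.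
set a := E _ _; set b := E _ _; set d := E _ _; set e := E _ _.
by rewrite sqrrD !mulrDl; lra.
Qed.

End FixedSize.

Lemma expRN_le (y : R) : 0 < y -> expR (- y) <= y^-1.
Proof.
move=> y0; rewrite expRN lef_pV2 ?posrE ?expR_gt0//.
by have := expR_ge1Dx y; lra.
Qed.

(** Square 1 + y <= e^y at y = d m / 2: a quadratic factor costs arbitrarily little of the
    exponential rate. *)
Lemma sqr_expR_le (d m : R) : 0 < d -> 0 <= m ->
  m ^+ 2 <= (2 / d) ^+ 2 * expR (d * m).
Proof.
move=> d0 m0.
have -> : d * m = d * m / 2 + d * m / 2 by lra.
rewrite expRD -expr2 -exprMn lerXn2r ?nnegrE ?mulr_ge0 ?expR_ge0 ?invr_ge0 ?(ltW d0)//.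
rewrite mulrAC ler_pdivlMr// mulrC -ler_pdivrMl//.
by have := expR_ge1Dx (d * m / 2); lra.
Qed.

(** Above the threshold the first-moment bound n^2 p is a negative power of n. It is recorded as O(1
    / ln n), the rate shared by both tails. *)
Lemma Pr_largest_repeat_gt (C kappa : R) : 0 < kappa ->
  (forall s, E (leaves s) (fun t => (S s t)%:R) <=
     C * (leaves s)%:R ^+ 2 * expR (- kappa * (leaves s)%:R)) ->
  forall eps : R, 0 < eps -> exists A : R, forall n, (2 <= n)%N ->
  E n (fun t => ((2 * ln 2 / kappa + eps) * log2 n%:R < (largest_repeat S t)%:R)%R%:R)
    <= A / ln n%:R.
Proof.
move=> kap0 shape_le eps eps0; pose b := 2 * ln 2 / kappa + eps.
have l2 := @ln2_gt0 R.
have C0 : 0 <= C.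
  have := shape_le Leaf; rewrite Etree1 /= mulr1n expr1n mulr1 => h.
  rewrite -(@pmulr_lge0 _ (expR (- kappa * 1))) ?expR_gt0//.
  exact: le_trans h.
have b0 : 0 < b by rewrite addr_gt0// !mulr_gt0// invr_gt0.
(* [d] spends half of the slack kappa * eps on the quadratic factor, so (kappa - d) * b = 2 ln 2 +
   kappa * eps / 2; the surplus over n^2 is the exponent [eta]. *)
pose d := kappa * eps / (2 * b).
have d0 : 0 < d by rewrite divr_gt0// mulr_gt0.
have dk : 0 < kappa - d.
  rewrite subr_gt0 ltr_pdivrMr ?mulr_gt0// ltr_pM2l//.
  have : 0 < 2 * ln 2 / kappa by rewrite !mulr_gt0// invr_gt0.
  by rewrite /b; lra.
pose eta := kappa * eps / (2 * ln 2).
have eta0 : 0 < eta by rewrite divr_gt0// mulr_gt0.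
pose C2 := C * (2 / d) ^+ 2.
have C20 : 0 <= C2 by rewrite mulr_ge0// sqr_ge0.
exists (C2 / eta) => n n2.
have lnn : 0 < ln n%:R :> R by rewrite ln_gt0// ltr1n.
pose x := b * log2 n%:R; have x0 : 0 <= x.
  by rewrite mulr_ge0 ?(ltW b0)// log2_ge0// ler1n; lia.
pose k := (Num.truncn x).+1.
have /andP[_ xk] := truncn_itv x0.
pose p := C2 * expR (- (kappa - d) * k%:R).
apply: (@le_trans _ _ (E n (fun t => (has_repeat k t)%:R))).
  apply: le_Etree => [|t tn]; first exact: ltnW.
  case: ltP => // xt; rewrite largest_repeat_ge//.
  by rewrite /k truncn_lt_nat.
apply: (le_trans (@Pr_has_repeat_le k p _ n isT (ltnW n2))).
  move=> s ks; apply: (le_trans (shape_le s)); rewrite /p /C2.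
  rewrite -!(mulrA C) ler_wpM2l//.
  apply: (@le_trans _ _ ((2 / d) ^+ 2 * expR (- (kappa - d) * (leaves s)%:R))); last first.
    by rewrite ler_wpM2l ?sqr_ge0// ler_expR !mulNr lerN2 ler_wpM2l ?(ltW dk)// ler_nat.
  have -> : - (kappa - d) * (leaves s)%:R = d * (leaves s)%:R + - kappa * (leaves s)%:R by lra.
  by rewrite expRD mulrA ler_wpM2r ?expR_ge0// sqr_expR_le.
rewrite /p mulrCA -[C2 / eta / _]mulrA ler_wpM2l//.
have -> : n%:R ^+ 2 = expR (2 * ln n%:R) :> R.
  by rewrite mulrDl mul1r expRD lnK ?posrE ?ltr0n ?(ltnW n2)// expr2.
rewrite -expRD -invfM; apply: le_trans (expRN_le (mulr_gt0 eta0 lnn)).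
rewrite ler_expR.
have h : (kappa - d) * x <= (kappa - d) * k%:R by rewrite ler_wpM2l ?(ltW dk)// ltW.
have -> : - (eta * ln n%:R) = 2 * ln n%:R - (kappa - d) * x.
  rewrite /x /log2 /eta /d; have : b != 0 by rewrite gt_eqF.
  have ll : ln 2 != 0 :> R by rewrite gt_eqF.
  have kk : kappa != 0 by rewrite gt_eqF.
  move=> bn0; have -> : (kappa - kappa * eps / (2 * b)) * (b * (ln n%:R / ln 2)) =
    (kappa * b - kappa * eps / 2) * (ln n%:R / ln 2).
    by field; rewrite bn0 ll.
  by rewrite /b; field; rewrite ll kk.
by lra.
Qed.

End UpperBound.

(** * Lower bound on repeated clades *)

(** The pieces are those left by cutting at every vertex of size above [M]. The weight [w] lets one
    definition give both the number of large pieces and the mass of small ones. *)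
Fixpoint cut_sum (w : nat -> nat) (M : nat) (t : bintree) : nat :=
  if t is Node l r then
    if (M < leaves l + leaves r)%N then (cut_sum w M l + cut_sum w M r)%N
    else w (leaves l + leaves r)%N
  else w 1.

Lemma cut_sum_small w M t : (leaves t <= M)%N -> cut_sum w M t = w (leaves t).
Proof. by case: t => //= l r; rewrite leqNgt => /negbTE->. Qed.

Lemma cut_sum_Node w M l r : (M < leaves l + leaves r)%N ->
  cut_sum w M (Node l r) = (cut_sum w M l + cut_sum w M r)%N.
Proof. by move=> /= ->. Qed.

(** A piece smaller than [m] is charged its leaves; any other has at most [M] leaves and is counted
    once. *)
Lemma leaves_le_cut_sum M m t : (0 < M)%N ->
  (leaves t <= cut_sum (fun j => if j < m then j else 0) M t +
     M * cut_sum (fun j => m <= j) M t)%N.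
Proof.
move=> M0; elim: t => [|l IHl r IHr] /=.
  by case: (ltnP 1 m) => _; rewrite ?muln1 ?muln0.
case: (ltnP M) => [_|lrM]; last by case: (ltnP _ m) => _ /=; rewrite ?muln1 ?muln0 ?addn0.
by rewrite mulnDr addnACA leq_add.
Qed.

Lemma divn_le_of_mass n w M c : (0 < M)%N -> (n <= w + M * c)%N ->
  (2 * w < n)%N -> (n %/ (2 * M) <= c)%N.
Proof.
move=> M0 h wn; rewrite -ltnS ltn_divLR ?muln_gt0//.
by rewrite mulSn mulnCA [(c * M)%N]mulnC; move: (M * c)%N h => x; lia.
Qed.

Section LowerBound.
Context {R : realType}.
Local Notation E := (@Etree R).
Local Notation harm := (@harm R).

(** The mean of the first m - 1 terms is at most the mean of all M, since [c] separates the prefix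
    from the rest; denominators are cleared. *)
Lemma prefix_average_le (a : nat -> R) (c : R) m M : (0 < m <= M.+1)%N ->
  (forall i, (1 <= i < m)%N -> a i <= c) ->
  (forall i, (m <= i < M.+1)%N -> c <= a i) ->
  M%:R * \sum_(1 <= i < m) a i <= m.-1%:R * \sum_(1 <= i < M.+1) a i.
Proof.
move=> /andP[m0 mM] lo hi.
rewrite (@big_cat_nat _ _ _ m 1 M.+1)//= mulrDr.
have S1 : \sum_(1 <= i < m) a i <= m.-1%:R * c.
  apply: (@le_trans _ _ (\sum_(1 <= i < m) c)); first exact: ler_sum_nat.
  by rewrite sumr_const_nat subn1 mulr_natl.
have S2 : (M.+1 - m)%:R * c <= \sum_(m <= i < M.+1) a i.
  apply: (@le_trans _ _ (\sum_(m <= i < M.+1) c)); last exact: ler_sum_nat.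
  by rewrite sumr_const_nat mulr_natl.
have -> : M%:R = m.-1%:R + (M.+1 - m)%:R :> R.
  by rewrite -natrD; congr (_%:R); lia.
rewrite mulrDl lerD2l.
apply: (@le_trans _ _ ((M.+1 - m)%:R * (m.-1%:R * c))); first by rewrite ler_wpM2l.
by rewrite mulrCA ler_wpM2l.
Qed.

Lemma sum_inv_sub n : (0 < n)%N ->
  \sum_(1 <= i < n) (n - i)%:R^-1 = harm n.-1.
Proof.
move=> n0; rewrite big_nat_rev /= /harm prednK//; apply: eq_big_nat => i /andP[i1 iltn].
by congr (_%:R^-1); lia.
Qed.

(** Follow a uniform leaf: its next clade has size i with probability proportional to 1 / (n - i).
    These weights increase with i, so among the sizes 1..M those below [m] get a share of at most (m
    - 1) / M. *)
Lemma Etree_small_mass_le m M n : (0 < m <= M)%N -> (M < n)%N ->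
  E n (fun t => (cut_sum (fun j => if j < m then j else 0)%N M t)%:R) <=
  n%:R * (m.-1%:R / M%:R).
Proof.
move=> /andP[m0 mM]; pose w (j : nat) := if (j < m)%N then j else 0%N.
set K := _ / _.
have M0 : (0 < M)%N by apply: leq_trans mM.
have K0 : 0 <= K by rewrite mulr_ge0 ?invr_ge0.
pose f t : R := (cut_sum w M t)%:R; rewrite -[leLHS]/(E n f).
elim/ltn_ind: n => n IH Mn.
have n2 : (2 <= n)%N by lia.
have n0 : n%:R != 0 :> R by rewrite pnatr_eq0; lia.
rewrite (EtreeS_add (g := f)) //; last first.
  by move=> l r lr; rewrite /f cut_sum_Node ?natrD// lr.
have -> : \sum_(1 <= i < n) split_prob n i * (E i f + E (n - i) f) =
    2 * \sum_(1 <= i < n) split_prob n i * E i f.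
  rewrite mulr_natl mulr2n [X in _ = _ + X]big_nat_rev -big_split /=.
  apply: eq_big_nat => i /andP[i1 iltn].
  by rewrite add1n subSS split_probC ?i1// mulrDr.
(* Bound on the share of mass lost in a child of size i: everything below [m], nothing up to [M],
   and [K] by induction above. *)
pose nu i : R := if (i < m)%N then 1 else if (i <= M)%N then 0 else K.
have nuP i : (1 <= i < n)%N -> E i f <= i%:R * nu i.
  move=> /andP[i1 iltn]; rewrite /nu.
  have [leiM|ltMi] := leqP i M.
    rewrite (@eq_Etree _ i _ (fun=> (w i)%:R)) ?Etree_cst//; last first.
      by move=> t ti; rewrite /f cut_sum_small ti.
    by rewrite /w; case: ltnP => _; rewrite ?mulr1 ?mulr0.
  by rewrite ltnNge (leq_trans mM (ltnW ltMi)) /= IH.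
have h0 : 0 < harm n.-1 by apply: harm_gt0; lia.
apply: (@le_trans _ _ (n%:R / harm n.-1 * \sum_(1 <= i < n) nu i * (n - i)%:R^-1)).
  rewrite !mulr_sumr; apply: ler_sum_nat => i /[dup] iin /andP[i1 iltn].
  apply: (@le_trans _ _ (2 * (split_prob n i * (i%:R * nu i)))).
    by rewrite !ler_wpM2l ?split_prob_ge0// nuP.
  rewrite /split_prob le_eqVlt; apply/orP; left; apply/eqP.
  have i0 : i%:R != 0 :> R by rewrite pnatr_eq0; lia.
  have j0 : (n - i)%:R != 0 :> R by rewrite pnatr_eq0; lia.
  by move: (gt_eqF h0) j0; set x := harm _; set y := (n - i)%:R => /negbT x0 y0;
    field; rewrite x0 y0 i0.
rewrite -mulrA ler_wpM2l// mulrC ler_pdivrMr// -sum_inv_sub; last by lia.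
rewrite [X in X <= _](@big_cat_nat _ _ _ M.+1)//= [X in _ <= K * X](@big_cat_nat _ _ _ M.+1)//=.
rewrite mulrDr lerD//; last first.
  rewrite mulr_sumr; apply: ler_sum_nat => i /andP[Mi _].
  have [im iM] : (i < m)%N = false /\ (i <= M)%N = false by split; lia.
  by rewrite /nu im iM.
rewrite (@big_cat_nat _ _ _ m)//=; last exact: ltnW.
rewrite [X in _ + X]big_nat_cond [X in _ + X]big1 ?addr0; last first.
  move=> i; rewrite andbT => /andP[mi iM]; rewrite /nu ltnNge mi /= -ltnS iM.
  by rewrite mul0r.
rewrite (eq_big_nat _ _ (F2 := fun i => (n - i)%:R^-1)); last first.
  by move=> i /andP[_ im]; rewrite /nu im mul1r.
rewrite /K mulrAC ler_pdivlMr ?ltr0n// mulrC.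
have inv_le (i j : nat) : (i <= j)%N -> (j < n)%N -> (n - i)%:R^-1 <= (n - j)%:R^-1 :> R.
  by move=> ij jn; rewrite lef_pV2 ?posrE ?ltr0n ?ler_nat; lia.
apply: (@prefix_average_le (fun i => (n - i)%:R^-1) ((n - m)%:R^-1)).
- by rewrite m0 ltnW.
- by move=> i /andP[_ im]; apply: inv_le; lia.
- by move=> i /andP[mi iM]; apply: inv_le; lia.
Qed.

(** On a large piece the mean of 2^-count is at most 1 - r / 2, which the factor (1 - r / 2)^-1
    compensates. The functional is multiplicative over independent subtrees, so the bound 1
    propagates above the cut. *)
Lemma Etree_discount_le (s : bintree) m M n (r : R) : leaves s = m ->
  (1 < m <= M)%N -> 0 <= r <= 1 ->
  (forall j, (m <= j <= M)%N ->
     r <= E j (fun t => (0 < count (eq_op s) (clades t))%N%:R)) ->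
  (0 < n)%N ->
  E n (fun t => 2^-1 ^+ count (eq_op s) (clades t) *
                (1 - r / 2)^-1 ^+ cut_sum (fun j => m <= j)%N M t) <= 1.
Proof.
move=> sm /andP[m1 mM] /andP[r0 r1] hr.
pose f t : R := 2^-1 ^+ count (eq_op s) (clades t) *
  (1 - r / 2)^-1 ^+ cut_sum (fun j => m <= j)%N M t.
rewrite -[E n _]/(E n f).
have rho0 : 0 < 1 - r / 2 by lra.
have f0 t : 0 <= f t by rewrite mulr_ge0// exprn_ge0// invr_ge0// ltW.
elim/ltn_ind: n => n IH n0.
have [nM|Mn] := leqP n M; last first.
  have n2 : (2 <= n)%N by lia.
  rewrite (EtreeS_mul (g1 := f) (g2 := f)) //; last first.
    move=> a b ab; rewrite /f cut_sum_Node ?ab// /= count_cat.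
    have -> : (s == Node a b) = false.
      by apply/negP => /eq_op_leaves /=; lia.
    by rewrite add0n !exprD mulrACA.
  apply: split_average_le => // i /andP[i1 iltn].
  have j0 : (0 < n - i)%N by lia.
  by rewrite mulr_ile1 ?IH//; [exact: Etree_ge0|exact: Etree_ge0|lia].
have [nm|mn] := ltnP n m.
  rewrite -[leRHS](Etree_cst n); apply: le_Etree => // t tn.
  rewrite /f cut_sum_small ?tn// leqNgt nm /= mulr1.
  by rewrite exprn_ile1// invf_le1// ler1n.
have hn : r <= E n (fun t => (0 < count (eq_op s) (clades t))%N%:R).
  by apply: hr; rewrite mn.
apply: (@le_trans _ _ (E n (fun t => (1 + - 2^-1 * (0 < count (eq_op s) (clades t))%N%:R) *
     (1 - r / 2)^-1))).
  apply: le_Etree => // t tn.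
  rewrite /f cut_sum_small ?tn// mn expr1 ler_wpM2r ?invr_ge0 ?(ltW rho0)//.
  case: (count _ _) => [|c]; first by rewrite expr0 /= mulr0 addr0.
  rewrite exprS /= mulr1 -[leRHS]mulr1.
  have -> : 1 + - 2^-1 = 2^-1 :> R by lra.
  by rewrite ler_wpM2l ?invr_ge0// exprn_ile1// ?invr_ge0// invf_le1// ler1n.
rewrite EtreeZr EtreeD Etree_cst EtreeZ ler_pdivrMr// mul1r.
by move: hn; set u := E _ _; lra.
Qed.

(** Only two events are used: [s] is the whole tree or its left child. The relevant split has
    probability at least 1 / (2 n^2), from h_(n-1) <= n and m (n - m) <= n^2. *)
Lemma clade_prob_ge (s : bintree) n : (1 < leaves s)%N -> (leaves s <= n)%N ->
  E (leaves s) (fun t => (s == t)%:R) / (2 * n%:R ^+ 2) <=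
  E n (fun t => (0 < count (eq_op s) (clades t))%N%:R).
Proof.
move=> s2 sn; have n0 : 0 < n%:R :> R by rewrite ltr0n; lia.
set p := E _ _; have p0 : 0 <= p by apply: Etree_ge0; rewrite ?leaves_gt0.
have root_count t : (1 < leaves t)%N -> s == t -> (0 < count (eq_op s) (clades t))%N.
  by case: t => //= l r _ ->.
have n2ge1 : 1 <= 2 * n%:R ^+ 2 :> R.
  by rewrite -natrX -natrM ler1n muln_gt0 expn_gt0; lia.
have [nE|neq] := eqVneq n (leaves s).
  apply: (@le_trans _ _ p).
    by rewrite ler_pdivrMr ?mulr_gt0 ?exprn_gt0// ler_peMr.
  rewrite nE; apply: le_Etree => [|t ts]; first exact: leaves_gt0.
  by case: eqP => // /eqP st; rewrite root_count// ts.
have n2 : (2 <= n)%N by lia.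
rewrite EtreeS// (bigD1_seq (leaves s)) ?iota_uniq//=; last first.
  by rewrite mem_index_iota; lia.
rewrite -[leLHS]addr0 lerD//; last first.
  rewrite big_seq_cond sumr_ge0// => i; rewrite mem_index_iota => /andP[/andP[i1 iltn] _].
  rewrite mulr_ge0 ?split_prob_ge0// Etree_ge0// => l _; rewrite Etree_ge0//; lia.
rewrite mulrC ler_pM ?invr_ge0 ?mulr_ge0 ?exprn_ge0//.
  rewrite /split_prob invfM; set m := leaves s.
  have h0 : 0 < harm n.-1 by apply: harm_gt0; lia.
  have hn : harm n.-1 <= n%:R by rewrite (le_trans (harm_le _))// ler_nat leq_pred.
  have mn : m%:R * (n - m)%:R <= n%:R ^+ 2 :> R.
    by rewrite -natrM -natrX ler_nat expnS expn1 leq_mul ?leq_subr.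
  have mn0 : 0 < m%:R * (n - m)%:R :> R.
    by rewrite -natrM ltr0n muln_gt0; move: neq s2 sn; rewrite /m => /eqP; lia.
  rewrite ler_pM ?invr_ge0 ?exprn_ge0//.
    by rewrite ler_pdivlMr ?mulr_gt0// mulrA mulVf ?mul1r.
  by rewrite lef_pV2 ?posrE ?exprn_gt0.
apply: le_Etree => [|l ls]; first exact: leaves_gt0.
rewrite -[leLHS](Etree_cst (n - leaves s)); apply: le_Etree => [|r rr].
  by move: neq => /eqP; lia.
case: eqP => //= /eqP sl; rewrite count_cat.
have := root_count l; rewrite ls s2 sl => /(_ isT isT).
by case: (count _ (clades l)) => //= c _; rewrite addnCA.
Qed.

(** One term for each way to fail: too much mass in small pieces, or too few copies in many large
    ones. Cutting at m^2 makes the expected lost fraction at most 1 / m and keeps clade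
    probabilities within a polynomial factor of [p]. *)
Lemma Pr_few_copies_le (s : bintree) n (p : R) : (1 < leaves s)%N -> (0 < n)%N ->
  p = E (leaves s) (fun t => (s == t)%:R) -> 0 < p ->
  E n (fun t => (count (eq_op s) (clades t) <= 1)%N%:R) <=
  2 / (leaves s)%:R + 16 * expR 1 * ((leaves s)%:R ^+ 6 / p) / n%:R.
Proof.
move=> s2 n0 pE p0; set m := leaves s in s2 pE *.
have m0 : 0 < m%:R :> R by rewrite ltr0n; lia.
have n0R : 0 < n%:R :> R by rewrite ltr0n.
have p1 : p <= 1.
  rewrite pE -[leRHS](Etree_cst m); apply: le_Etree => // [|t _]; first by lia.
  by case: eqP.
have e1 : 1 <= expR 1 :> R by have := @expR_ge1Dx R 1; lra.
pose M := (m ^ 2)%N.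
have mM : (m <= M)%N by rewrite /M expnS expn1 leq_pmulr//; lia.
have M0 : (0 < M)%N by lia.
(* For n <= m^2 the second term is already at least 1. *)
have [nM|Mn] := leqP n M.
  apply: (@le_trans _ _ 1).
    rewrite -[leRHS](Etree_cst n); apply: le_Etree => // t _.
    by case: (_ <= _)%N.
  rewrite -[leLHS]add0r lerD ?divr_ge0// ler_pdivlMr// mul1r.
  apply: (@le_trans _ _ (m%:R ^+ 6)).
    apply: (@le_trans _ _ (m%:R ^+ 2)); first by rewrite -natrX ler_nat.
    by rewrite ler_weXn2l// ler1n; lia.
  have m6 : m%:R ^+ 6 <= m%:R ^+ 6 / p by rewrite ler_pdivlMr// ler_piMr// exprn_ge0.
  apply: (le_trans m6); rewrite ler_peMl ?divr_ge0 ?exprn_ge0// ?(ltW p0)//.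
  by lra.
pose r := p / (2 * M%:R ^+ 2).
have M0R : 0 < M%:R :> R by rewrite ltr0n.
have M1R : 1 <= M%:R :> R by rewrite ler1n.
have r0 : 0 < r by rewrite divr_gt0// mulr_gt0// exprn_gt0.
have r1 : r <= 1.
  rewrite ler_pdivrMr ?mulr_gt0 ?exprn_gt0// mul1r (le_trans p1)//.
  by have : 1 <= M%:R ^+ 2 :> R; [rewrite exprn_ege1|lra].
have hr j : (m <= j <= M)%N -> r <= E j (fun t => (0 < count (eq_op s) (clades t))%N%:R).
  move=> /andP[mj jM]; apply: le_trans (clade_prob_ge s2 mj).
  have j0 : 0 < j%:R :> R by rewrite ltr0n; apply: leq_trans mj; exact: ltnW.
  rewrite -/m -pE /r ler_wpM2l ?(ltW p0)// lef_pV2 ?posrE ?mulr_gt0 ?exprn_gt0//.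
  by rewrite ler_wpM2l// lerXn2r ?nnegrE// ler_nat.
pose rho := 1 - r / 2; have rho0 : 0 < rho by rewrite /rho; lra.
have rho1 : rho <= 1 by rewrite /rho; lra.
pose b := (n %/ (2 * M))%N.
pose Z t := count (eq_op s) (clades t).
pose B t := cut_sum (fun j => m <= j)%N M t.
pose W t := cut_sum (fun j => if j < m then j else 0)%N M t.
have disc : E n (fun t => 2^-1 ^+ Z t * rho^-1 ^+ B t) <= 1.
  by apply: (@Etree_discount_le s m M n r) => //; rewrite ?s2 ?mM ?(ltW r0) ?r1.
have mass : E n (fun t => (W t)%:R) <= n%:R * (m.-1%:R / M%:R).
  by apply: Etree_small_mass_le => //; rewrite mM andbT; exact: ltnW.
(* Two Markov bounds at once: if 2 W >= n the first summand is at least 1; otherwise B >= b, and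
   having at most one copy gives 2 * 2^-Z >= 1. *)
apply: (@le_trans _ _ (E n (fun t => 2 / n%:R * (W t)%:R +
   2 * rho ^+ b * (2^-1 ^+ Z t * rho^-1 ^+ B t)))).
  apply: le_Etree => // t tn.
  have pos1 : 0 <= 2 / n%:R * (W t)%:R :> R by rewrite mulr_ge0 ?divr_ge0.
  have pos2 : 0 <= 2 * rho ^+ b * (2^-1 ^+ Z t * rho^-1 ^+ B t).
    by rewrite !mulr_ge0 ?exprn_ge0 ?invr_ge0 ?(ltW rho0).
  rewrite -/(Z t); case: leqP => Z1; last by rewrite addr_ge0.
  have [Wn|nW] := leqP n (2 * W t).
    rewrite -[leLHS]addr0 lerD// mulrAC ler_pdivlMr// mul1r -natrM ler_nat.
    exact: Wn.
  rewrite -[leLHS]add0r lerD//.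
  have bB : (b <= B t)%N.
    apply: (@divn_le_of_mass _ (W t)) => //.
    by rewrite -[n in leqLHS]tn leaves_le_cut_sum.
  have -> : 2 * rho ^+ b * (2^-1 ^+ Z t * rho^-1 ^+ B t) =
     (2 * 2^-1 ^+ Z t) * (rho^-1 ^+ (B t - b)).
    rewrite -{1}(subnK bB) exprD mulrACA -!mulrA; congr (_ * (_ * _)).
    by rewrite mulrCA -exprMn divff ?expr1n ?mulr1// gt_eqF.
  rewrite -[leLHS]mulr1 ler_pM//.
    by move: Z1; rewrite leq_eqVlt ltnS leqn0 => /orP[]/eqP->; rewrite /= ?expr1 ?expr0; lra.
  by rewrite exprn_ege1// invf_ge1.
rewrite EtreeD !EtreeZ lerD//.
  apply: (@le_trans _ _ (2 / n%:R * (n%:R * (m.-1%:R / M%:R)))).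
    by rewrite ler_wpM2l// divr_ge0.
  rewrite mulrA mulfVK ?gt_eqF// ler_wpM2l// /M natrX expr2.
  rewrite ler_pdivrMr ?mulr_gt0// mulrA mulVf ?gt_eqF// mul1r ler_nat.
  exact: leq_pred.
apply: (@le_trans _ _ (2 * rho ^+ b)).
  by rewrite -[leRHS]mulr1 ler_wpM2l// mulr_ge0 ?exprn_ge0 ?(ltW rho0).
(* [y] equals (r / 2) * n / (2 M); the rounding in [b] costs at most a factor e. *)
pose y := p * n%:R / (8 * m%:R ^+ 6).
have y0 : 0 < y by rewrite divr_gt0 ?mulr_gt0 ?exprn_gt0.
have rho_le : rho ^+ b <= expR (1 - y).
  apply: (@le_trans _ _ (expR (- (r / 2)) ^+ b)).
    rewrite lerXn2r ?nnegrE ?expR_ge0 ?(ltW rho0)//.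
    by have := @expR_ge1Dx R (- (r / 2)); rewrite /rho; lra.
  rewrite -expRM_natr ler_expR.
  have bn : n%:R / (2 * M%:R) <= b%:R + 1 :> R.
    rewrite ler_pdivrMr ?mulr_gt0// natr1 -!natrM ler_nat ltnW//.
    by rewrite ltn_ceil// muln_gt0.
  have yE : y = r / 2 * (n%:R / (2 * M%:R)).
    rewrite /y /r /M natrX; field.
    by rewrite gt_eqF.
  have : r / 2 * (n%:R / (2 * M%:R)) <= r / 2 * (b%:R + 1).
    by rewrite ler_wpM2l//; lra.
  by rewrite -yE; lra.
have := expRN_le y0; rewrite expRB in rho_le => ey.
apply: (@le_trans _ _ (2 * (expR 1 * y^-1))).
  by rewrite ler_wpM2l// (le_trans rho_le)// -expRN ler_wpM2l ?expR_ge0.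
rewrite /y le_eqVlt; apply/orP; left; apply/eqP.
by field; rewrite !gt_eqF ?exprn_gt0.
Qed.

End LowerBound.

(** * A common shape and the lower tail *)

Section CommonTree.
Context {R : realType}.
Local Notation E := (@Etree R).

(** 2^k dominates c * k^3, so the first term suffices once eta * c * k >= 1; for smaller k the
    constant does. *)
Lemma sqr_le_exp2 (eta : R) : 0 < eta ->
  exists C : R, forall k : nat, k%:R ^+ 2 <= eta * 2 ^+ k + C.
Proof.
move=> eta0; pose c : R := ln 2 ^+ 3 / 6.
have l2 := @ln2_gt0 R.
have c0 : 0 < c by rewrite divr_gt0// exprn_gt0.
have ec0 : 0 < eta * c by rewrite mulr_gt0.
exists ((eta * c)^-1 ^+ 2) => k.
have k0 : 0 <= k%:R :> R by [].
have ck : c * k%:R ^+ 3 <= 2 ^+ k.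
  have -> : 2 ^+ k = expR (k%:R * ln 2) :> R by rewrite mulrC expRM_natr lnK ?posrE.
  have := @expR_ge1Dxn R (k%:R * ln 2) 2 (mulr_ge0 k0 (ltW l2)).
  by rewrite /c exprMn (_ : 3`!%:R = 6 :> R)//; lra.
have [h|/ltW h] := leP 1 (eta * c * k%:R).
  rewrite -[leLHS]addr0 lerD ?exprn_ge0 ?invr_ge0 ?(ltW ec0)//.
  apply: (@le_trans _ _ (eta * (c * k%:R ^+ 3))); last by rewrite ler_wpM2l// ltW.
  by rewrite mulrA [_ ^+ 3]exprS mulrA ler_peMl ?exprn_ge0.
rewrite -[leLHS]add0r lerD ?mulr_ge0 ?exprn_ge0 ?(ltW eta0)//.
rewrite lerXn2r ?nnegrE ?invr_ge0 ?(ltW ec0)//.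
by rewrite -[leRHS]mul1r ler_pdivlMr// mulrC.
Qed.

Lemma common_tree (eta : R) : 0 < eta ->
  exists C : R, forall m, (2 <= m)%N -> exists2 s, leaves s = m &
    0 < E m (fun t => (s == t)%:R) /\
    m%:R ^+ 6 / E m (fun t => (s == t)%:R) <=
      expR ((alpha R * ln 2 + eta) * m%:R + C).
Proof.
move=> eta0; have l2 := @ln2_gt0 R.
(* The factor m^5 contributes 5 k and [light_tree] contributes k^2, at most 6 k^2 in all; with 2^k
   <= 2 m this gives 12. *)
have [|C0 hC] := @sqr_le_exp2 (eta / (12 * ln 2)).
  by rewrite divr_gt0// mulr_gt0.
exists (6 * ln 2 * C0) => m m2.
have m0 : (0 < m)%N by lia.
have [pm mp] : (2 ^ trunc_log 2 m <= m)%N /\ (m < 2 ^ (trunc_log 2 m).+1)%N.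
  by split; [exact: trunc_logP|exact: trunc_log_ltn].
set k := (trunc_log 2 m).+1 in mp *.
have [|s sm hs] := @light_tree R k m; first by rewrite m0.
exists s => //; rewrite -{1 3}sm Pr_shape sm.
have h0 := @hprod_gt0 R s; have m0R : 0 < m%:R :> R by rewrite ltr0n.
have p0 : 0 < 2 ^+ m.-1 * @hprod R s by rewrite mulr_gt0// exprn_gt0.
split; first by rewrite divr_gt0.
set h := hprod s in h0 hs p0 *; set D := 2 ^+ m.-1 in p0 *.
have D0 : 0 < D by rewrite exprn_gt0.
have -> : m%:R ^+ 6 / (m%:R / (D * h)) = m%:R ^+ 5 * (D * h).
  by field; rewrite !gt_eqF.
have mk : m%:R <= expR (ln 2 * k%:R) :> R.
  by rewrite expRM_natr lnK ?posrE// -natrX ler_nat ltnW.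
have Dm : D <= expR (ln 2 * m%:R).
  by rewrite expRM_natr lnK ?posrE// ler_weXn2l ?ler1n// leq_pred.
have hle : h <= expR (ln 2 * (m%:R * (alpha R - 1) + k%:R ^+ 2)).
  by rewrite -[leLHS]expR_ln2M// ler_expR ler_wpM2l ?(ltW l2).
have m5 : m%:R ^+ 5 <= expR (ln 2 * k%:R * 5) :> R.
  by rewrite expRM_natr lerXn2r ?nnegrE ?expR_ge0.
have kk : k%:R <= k%:R ^+ 2 :> R by rewrite -natrX ler_nat expnS expn1 leq_pmulr.
have k2m : 2 ^+ k <= 2 * m%:R :> R by rewrite exprS ler_wpM2l// -natrX ler_nat.
have hk : ln 2 * (6 * k%:R ^+ 2) <= eta * m%:R + 6 * ln 2 * C0.
  have -> : eta * m%:R + 6 * ln 2 * C0 =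
      ln 2 * (6 * (eta / (12 * ln 2) * (2 * m%:R) + C0)).
    by field; rewrite gt_eqF.
  rewrite ler_wpM2l ?(ltW l2)// ler_wpM2l// (le_trans (hC k))// lerD2r.
  by rewrite ler_wpM2l// divr_ge0 ?mulr_ge0 ?(ltW l2) ?(ltW eta0).
apply: (@le_trans _ _ (expR (ln 2 * k%:R * 5) * (expR (ln 2 * m%:R) *
    expR (ln 2 * (m%:R * (alpha R - 1) + k%:R ^+ 2))))).
  by rewrite !ler_pM ?mulr_ge0 ?exprn_ge0 ?(ltW D0) ?(ltW h0).
rewrite -!expRD ler_expR.
have : ln 2 * k%:R * 5 <= ln 2 * (5 * k%:R ^+ 2) :> R.
  by rewrite -mulrA ler_wpM2l ?(ltW l2)// mulrC ler_wpM2l.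
by move: hk; set u := ln 2; set v := k%:R ^+ 2; set w := k%:R; set a := alpha R; lra.
Qed.

(** Equal ordered shapes are related by any reflexive [S], so ordered copies also give the unordered
    lower bound. *)
Lemma largest_repeat_ge_copies (S : rel bintree) s t : reflexive S ->
  (2 <= count (eq_op s) (clades t))%N -> (leaves s <= largest_repeat S t)%N.
Proof.
move=> Sxx c2; apply: leq_bigmax_seq.
  by move: c2 => /ltnW; rewrite -has_count => /hasP[u ut /eqP->].
by apply: leq_trans c2 _; apply: sub_count => u /= /eqP <-.
Qed.

Lemma Pr_largest_repeat_lt (S : rel bintree) (eps : R) : reflexive S ->
  0 < alpha R -> 0 < eps -> exists A : R, forall n, (2 <= n)%N ->
  E n (fun t => ((largest_repeat S t)%:R < (1 / alpha R - eps) * log2 n%:R)%R%:R)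
    <= A / ln n%:R.
Proof.
move=> Sxx a0 eps0; set a := alpha R in a0 *; set c := 1 / a - eps.
have l2 := @ln2_gt0 R.
(* For c <= 0 the threshold is nonpositive and the event is empty. *)
have [c0|c0] := leP c 0.
  exists 0 => n n2; rewrite mul0r -[leRHS](Etree_cst n).
  apply: le_Etree => [|t _]; first by lia.
  rewrite ltNge (le_trans _ (ler0n _ _))// mulr_le0_ge0// log2_ge0// ler1n; lia.
(* Chosen so that (a * ln 2 + eta) * c / ln 2 = 1 - a * eps / 2, which saves the power [th] of n. *)
pose eta := a * eps * ln 2 / (2 * c).
have eta0 : 0 < eta by rewrite !mulr_gt0// invr_gt0 mulr_gt0.
have [C hC] := common_tree eta0.
pose C2 := (a * ln 2 + eta) * 2 + C.
pose th := a * eps / 2.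
have th0 : 0 < th by rewrite divr_gt0// mulr_gt0.
exists (2 * ln 2 / c + 16 * expR 1 * expR C2 / th) => n n2.
have lnn : 0 < ln n%:R :> R by rewrite ln_gt0// ltr1n.
have n1 : (0 < n)%N by exact: ltnW.
have n0 : 0 < n%:R :> R by rewrite ltr0n.
pose x := c * log2 n%:R.
have x0 : 0 < x by rewrite mulr_gt0// divr_gt0.
have /andP[tx xt] := truncn_itv (ltW x0).
(* Two above the floor, so that m > x and also m >= 2, as [common_tree] requires. *)
pose m := (Num.truncn x).+2.
have xm : x < m%:R by rewrite (lt_trans xt)// ltr_nat.
have mx : m%:R <= x + 2 by rewrite /m -[_.+2]addn2 natrD lerD2r.
have [s sm [p0 hp]] := hC m isT.
apply: (@le_trans _ _ (E n (fun t => (count (eq_op s) (clades t) <= 1)%N%:R))).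
  apply: le_Etree => // t _.
  case: ltP => // Rx; rewrite leqNgt; case: ltnP => // c2.
  have := largest_repeat_ge_copies Sxx c2; rewrite sm -(ler_nat R) => mR.
  by have := lt_trans (le_lt_trans mR Rx) xm; rewrite ltxx.
apply: le_trans (@Pr_few_copies_le R s n _ _ _ erefl _) _; rewrite ?sm//.
rewrite [leRHS]mulrDl lerD//.
  apply: (@le_trans _ _ (2 / x)).
    by rewrite ler_wpM2l// lef_pV2 ?posrE ?ltW// (lt_trans x0).
  rewrite /x /log2 le_eqVlt; apply/orP; left; apply/eqP.
  by field; rewrite !gt_eqF.
rewrite -[leLHS]mulrA -[leRHS]mulrA -[leRHS]mulrA ler_wpM2l ?mulr_ge0 ?expR_ge0//.
apply: (@le_trans _ _ (expR ((a * ln 2 + eta) * m%:R + C) / n%:R)).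
  by rewrite ler_wpM2r ?invr_ge0 ?(ltW n0).
have -> : n%:R^-1 = expR (- ln n%:R) :> R by rewrite expRN lnK ?posrE.
rewrite -expRD.
apply: (@le_trans _ _ (expR (C2 + - (th * ln n%:R)))).
  rewrite ler_expR.
  have : (a * ln 2 + eta) * m%:R <= (a * ln 2 + eta) * (x + 2).
    by rewrite ler_wpM2l// ltW// addr_gt0// mulr_gt0.
  have -> : (a * ln 2 + eta) * (x + 2) =
     ln n%:R - th * ln n%:R + (a * ln 2 + eta) * 2.
    rewrite /x /log2 mulrDr; congr (_ + _); rewrite /eta /th.
    have -> : (a * ln 2 + a * eps * ln 2 / (2 * c)) * (c * (ln n%:R / ln 2)) =
       (a * c + a * eps / 2) * ln n%:R by field; rewrite !gt_eqF.
    by rewrite /c; field; rewrite gt_eqF.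
  by rewrite /C2; set u := ln n%:R; lra.
by rewrite expRD ler_wpM2l ?expR_ge0// -invfM expRN_le// mulr_gt0.
Qed.

End CommonTree.

(** * Numerical value of alpha *)

Section NumericalBounds.
Context {R : realType}.
Local Notation harm := (@harm R).

(** Nested form of the series: the powers y_i of 2 with these exponents satisfy y_i = h_i *
    sqrt(y_(i+1)), so integer square roots evaluate them without logarithms. *)
Fixpoint cost_tail (i n : nat) : R :=
  if n is n'.+1 then node_cost (2 ^ i) + cost_tail i.+1 n' / 2 else 0.

(** The term j = 1 vanishes since h_1 = 1; starting at j = 2 gives the factor 1 / 4. *)
Lemma balanced_defectE n : balanced_defect n.+2 1 = cost_tail 2 n / 4.
Proof.
have E i k : \sum_(i <= j < i + k) node_cost (2 ^ j * 1) / 2 ^+ j =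
    cost_tail i k / 2 ^+ i :> R.
  elim: k i => [|k IH] i; first by rewrite addn0 big_geq// mul0r.
  rewrite big_ltn; last by rewrite addnS ltnS leq_addr.
  by rewrite -addSnnS IH /= muln1 mulrDl -mulrA -invfM -exprS.
rewrite /balanced_defect big_ltn// expn1 muln1 /node_cost /= harmS harm0 add0r.
rewrite invr1 /log2 ln1 !mul0r add0r (E 2%N n); congr (_ / _).
by rewrite expr2; lra.
Qed.

Lemma harm_pow2_gt0 i : 0 < harm (2 ^ i.+1).-1.
Proof.
have i0 : (0 < 2 ^ i)%N by rewrite expn_gt0.
by apply: harm_gt0; rewrite expnS; lia.
Qed.

Lemma expR_cost_tailS i n :
  expR (ln 2 * cost_tail i.+1 n.+1) =
  harm (2 ^ i.+1).-1 * expR (ln 2 * cost_tail i.+2 n / 2).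
Proof.
by rewrite /= mulrDr expRD mulrA expR_ln2M// harm_pow2_gt0.
Qed.

Lemma harm_pow2S_le i : harm (2 ^ i.+1).-1 <= harm (2 ^ i).-1 + 1.
Proof.
have H n d : harm (n + d) <= harm n + d%:R / n.+1%:R.
  elim: d => [|d IH]; first by rewrite addn0 mul0r addr0.
  rewrite addnS harmS -[d.+1%:R]natr1 mulrDl mul1r addrA lerD//.
  by rewrite lef_pV2 ?posrE// ler_nat ltnS leq_addr.
have i0 : (0 < 2 ^ i)%N by rewrite expn_gt0.
have -> : ((2 ^ i.+1).-1 = (2 ^ i).-1 + 2 ^ i)%N by rewrite expnS; lia.
by apply: (le_trans (H _ _)); rewrite prednK// divff// pnatr_eq0 -lt0n.
Qed.

(* AM-GM: h (h + 2) <= (h + 1) ^ 2 makes (h_i + 1) ^ 2 a supersolution of the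
   recursion y_i = h_i sqrt(y_(i+1)) satisfied by the tails. *)
Lemma expR_cost_tail_le i n :
  expR (ln 2 * cost_tail i.+1 n) <= (harm (2 ^ i.+1).-1 + 1) ^+ 2.
Proof.
elim: n i => [|n IH] i.
  by rewrite mulr0 expR0 exprn_ege1// lerDr harm_ge0.
have h0 := harm_pow2_gt0 i; have hS := harm_pow2S_le i.+1.
rewrite expR_cost_tailS; move: h0 hS (IH i.+1).
set h := harm _; set h' := harm _ => h0 hS.
set x := ln 2 * _ => xle.
have : expR (x / 2) <= h' + 1.
  rewrite -(@ler_pXn2r _ 2)// ?nnegrE ?expR_ge0//; last by rewrite addr_ge0// harm_ge0.
  by rewrite -expRM_natr mulfVK.
move=> e; apply: (@le_trans _ _ (h * (h + 2))).
  by rewrite ler_wpM2l ?(ltW h0)//; lra.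
by rewrite sqrrD1; lra.
Qed.

(** * Certified bounds on [alpha] by integer arithmetic *)

Definition NR (b : N) : R := (N.to_nat b)%:R.

Lemma NRD a b : NR (N.add a b) = NR a + NR b.
Proof. by rewrite /NR N2Nat.inj_add plusE natrD. Qed.

Lemma NRM a b : NR (N.mul a b) = NR a * NR b.
Proof. by rewrite /NR N2Nat.inj_mul multE natrM. Qed.

Lemma NRX a (k : nat) : NR (N.pow a (N.of_nat k)) = NR a ^+ k.
Proof.
elim: k => [|k IH]; first by rewrite /= /NR.
by rewrite Nat2N.inj_succ N.pow_succ_r' NRM IH exprS.
Qed.

Lemma NR_bin k : NR (N.of_nat k) = k%:R.
Proof. by rewrite /NR Nat2N.id. Qed.

Lemma NR_ge0 a : 0 <= NR a.
Proof. exact: ler0n. Qed.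

Lemma le_NR a b : N.le a b -> NR a <= NR b.
Proof. by move=> /N.sub_add <-; rewrite NRD lerDr NR_ge0. Qed.

Lemma leb_NR a b : N.leb a b -> NR a <= NR b.
Proof. by move=> /N.leb_le /le_NR. Qed.

Lemma NR_gt0 a : a <> N0 -> 0 < NR a.
Proof.
move=> a0; apply: (@lt_le_trans _ _ (NR (Npos xH))); first by rewrite /NR ltr01.
by apply: le_NR; case: a a0 => // p _; exact: Pos.le_1_l.
Qed.

Lemma NR_div_le a b : b <> N0 -> NR (N.div a b) * NR b <= NR a.
Proof. by move=> b0; rewrite mulrC -NRM; apply/le_NR/N.Div0.mul_div_le. Qed.

Lemma NR_div_ge a b : b <> N0 -> NR a <= (NR (N.div a b) + 1) * NR b.
Proof.
move=> b0; have -> : 1 = NR (Npos xH) by rewrite /NR.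
rewrite -NRD mulrC -NRM; apply/le_NR/N.lt_le_incl.
by rewrite N.add_1_r; apply: N.mul_succ_div_gt.
Qed.

Lemma NR_sqrt_le a : NR (N.sqrt a) ^+ 2 <= NR a.
Proof.
by rewrite expr2 -NRM; apply: le_NR; apply: (N.sqrt_spec a (N.le_0_l a)).1.
Qed.

Lemma NR_sqrt_ge a : NR a <= (NR (N.sqrt a) + 1) ^+ 2.
Proof.
have -> : 1 = NR (Npos xH) by rewrite /NR.
rewrite -NRD expr2 -NRM; apply/le_NR/N.lt_le_incl.
by rewrite N.add_1_r; apply: (N.sqrt_spec a (N.le_0_l a)).2.
Qed.

(* Doubling j -> 2j, 2j+1 compares consecutive dyadic blocks of the harmonic
   series. *)
Lemma harm_block_ge n d : (0 < n)%N ->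
  harm (n + d).-1 - harm n.-1 - d%:R / (4 * n%:R ^+ 2) <=
  harm (2 * (n + d)).-1 - harm (2 * n).-1.
Proof.
move=> n0; elim: d => [|d IH]; first by rewrite addn0 mul0r !subrr.
have nd0 : (0 < n + d)%N by rewrite ltn_addr.
have -> : (2 * (n + d.+1)).-1 = (2 * (n + d)).-1.+2 by lia.
have -> : ((n + d.+1).-1 = (n + d).-1.+1)%N by lia.
rewrite !harmS !prednK ?muln_gt0//.
set k := (n + d)%N in IH nd0 *; have k0 : 0 < k%:R :> R by rewrite ltr0n.
have n0R : 0 < n%:R :> R by rewrite ltr0n.
have nk : n%:R <= k%:R :> R by rewrite ler_nat leq_addr.
have I1 : k%:R^-1 - 1 / (4 * n%:R ^+ 2) <= (2 * k)%:R^-1 + (2 * k).+1%:R^-1 :> R.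
  rewrite -[(2 * k).+1%:R]natr1 natrM.
  apply: (@le_trans _ _ (k%:R^-1 - 1 / (4 * k%:R ^+ 2))).
    rewrite lerD2l lerN2 !div1r lef_pV2 ?posrE ?mulr_gt0 ?exprn_gt0//.
    by rewrite ler_wpM2l// lerXn2r ?nnegrE.
  rewrite -subr_ge0.
  have -> : (2%:R * k%:R)^-1 + (2%:R * k%:R + 1)^-1 - (k%:R^-1 - 1 / (4 * k%:R ^+ 2)) =
     ((4 * k%:R ^+ 2) * (2 * k%:R + 1))^-1 :> R.
    by field; rewrite !gt_eqF// addr_gt0// mulr_gt0.
  by rewrite invr_ge0 ?mulr_ge0 ?exprn_ge0 ?addr_ge0 ?mulr_ge0.
rewrite -[d.+1%:R]natr1 mulrDl; move: IH I1.
by set a := harm _; set b := harm _; set c := harm _; set e := harm _;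
  set u := k%:R^-1; set v := _^-1; set w := _^-1; set z := _.+1%:R^-1; lra.
Qed.

(** By [harm_block_ge] a block sum drops by at most 2^-(i+2) at the next scale; subtracting 2^-(i+1)
    absorbs these geometric losses. *)
Lemma harm_dyadic_ge k i : (k <= i)%N ->
  harm (2 ^ k.+1).-1 - harm (2 ^ k).-1 - (2 ^+ k.+1)^-1 <=
  harm (2 ^ i.+1).-1 - harm (2 ^ i).-1 - (2 ^+ i.+1)^-1.
Proof.
elim: i => [|i IH]; first by rewrite leqn0 => /eqP->.
rewrite leq_eqVlt => /predU1P[->//|/IH/le_trans]; apply.
have i0 : (0 < 2 ^ i)%N by rewrite expn_gt0.
have := harm_block_ge (2 ^ i) i0; rewrite addnn -mul2n -!expnS natrX.
have -> : 2 ^+ i / (4 * (2 ^+ i) ^+ 2) = (2 ^+ i.+2)^-1 :> R.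
  by rewrite !exprS; field; rewrite expf_neq0.
have -> : (2 ^+ i.+1)^-1 = 2 * (2 ^+ i.+2)^-1 :> R.
  by rewrite [in RHS]exprS invfM mulrA divff ?mul1r.
by set a := harm _; set b := harm _; set c := harm _; set v := _^-1; lra.
Qed.

Section FixedPoint.
(* A fixed-point number a : N stands for a / scale. *)
Variable scale : N.
Hypothesis scale_neq0 : scale <> N0.

Lemma scale_gt0 : 0 < NR scale.
Proof. exact: NR_gt0. Qed.

Fixpoint harm_floor (k : nat) : N :=
  if k is k'.+1 then N.add (harm_floor k') (N.div scale (N.of_nat k)) else N0.

Lemma N_of_natS_neq0 k : N.of_nat k.+1 <> N0.
Proof. by []. Qed.

Lemma harm_floor_le k : NR (harm_floor k) <= NR scale * harm k.
Proof.
elim: k => [|k IH]; first by rewrite harm0 mulr0.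
rewrite harmS mulrDr [harm_floor _]/= NRD lerD// ler_pdivlMr// -[k.+1%:R]NR_bin.
exact/NR_div_le/N_of_natS_neq0.
Qed.

(** Each rounded quotient loses at most one unit. *)
Lemma harm_floor_ge k : NR scale * harm k <= NR (N.add (harm_floor k) (N.of_nat k)).
Proof.
rewrite NRD NR_bin; elim: k => [|k IH]; first by rewrite harm0 mulr0 addr0.
rewrite harmS mulrDr [harm_floor _]/= NRD -[in leRHS]natr1 addrACA lerD//.
rewrite ler_pdivrMr// -[X in _ * X]NR_bin.
exact/NR_div_ge/N_of_natS_neq0.
Qed.

(** Fixed-point form of h * sqrt(y), rounded down; [sqrt_step_up] adds a unit before and after the
    root to round up. *)
Definition sqrt_step (a y : N) : N :=
  N.sqrt (N.div (N.mul (N.mul a a) y) scale).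

Definition sqrt_step_up (a y : N) : N :=
  N.add (N.sqrt (N.add (N.div (N.mul (N.mul a a) y) scale) (Npos xH))) (Npos xH).

Lemma foldr_sqrt_step_le (l : seq N) i :
  (forall j, (j < size l)%N -> NR (nth N0 l j) <= NR scale * harm (2 ^ (i.+1 + j)).-1) ->
  NR (foldr sqrt_step scale l) <= NR scale * expR (ln 2 * cost_tail i.+1 (size l)).
Proof.
have D0 := scale_gt0.
elim: l i => [|a l IH] i hl; first by rewrite /= mulr0 expR0 mulr1.
have ha := hl 0%N isT; rewrite addn0 /= in ha.
have {}IH : NR (foldr sqrt_step scale l) <=
    NR scale * expR (ln 2 * cost_tail i.+2 (size l)).
  by apply: IH => j jl; rewrite addSnnS; exact: (hl j.+1).
rewrite [size _]/= expR_cost_tailS; set x := ln 2 * _ in IH *.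
set h := harm _ in ha *; have h0 : 0 < h := harm_pow2_gt0 i.
set y := foldr _ _ _ in IH.
rewrite -(@ler_pXn2r _ 2)// ?nnegrE ?NR_ge0//; last first.
  by rewrite !mulr_ge0 ?expR_ge0 ?(ltW h0) ?(ltW D0).
rewrite [foldr _ _ _]/= -/y; apply: (le_trans (NR_sqrt_le _)).
rewrite -(ler_pM2r D0).
apply: (le_trans (NR_div_le _ scale_neq0)).
rewrite !NRM -expr2 2!exprMn -expRM_natr mulfVK//.
have -> : NR scale ^+ 2 * (h ^+ 2 * expR x) * NR scale =
  (NR scale * h) ^+ 2 * (NR scale * expR x) by ring.
by rewrite ler_pM ?exprn_ge0 ?NR_ge0// lerXn2r ?nnegrE ?NR_ge0 ?mulr_ge0 ?(ltW h0).
Qed.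

Lemma foldr_sqrt_step_up_ge (l : seq N) b i n :
  (forall j, (j < size l)%N -> NR scale * harm (2 ^ (i.+1 + j)).-1 <= NR (nth N0 l j)) ->
  NR scale * expR (ln 2 * cost_tail (size l + i.+1) n) <= NR b ->
  NR scale * expR (ln 2 * cost_tail i.+1 (size l + n)) <= NR (foldr sqrt_step_up b l).
Proof.
have D0 := scale_gt0.
elim: l i => [|a l IH] i hl hb //.
have ha := hl 0%N isT; rewrite addn0 /= in ha.
have /IH {}IH : forall j, (j < size l)%N ->
    NR scale * harm (2 ^ (i.+2 + j)).-1 <= NR (nth N0 l j).
  by move=> j jl; rewrite addSnnS; exact: (hl j.+1).
rewrite -addSnnS in IH; have {}IH := IH hb.
rewrite [size _]/= addSn expR_cost_tailS; set x := ln 2 * _ in IH *.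
set h := harm _ in ha *; have h0 : 0 < h := harm_pow2_gt0 i.
rewrite [foldr _ _ _]/=; set y := foldr _ _ _ in IH *.
rewrite -(@ler_pXn2r _ 2)// ?nnegrE ?NR_ge0//; last first.
  by rewrite !mulr_ge0 ?expR_ge0 ?(ltW h0) ?(ltW D0).
rewrite NRD; apply: le_trans (NR_sqrt_ge _); rewrite NRD.
rewrite -(ler_pM2r D0).
apply: le_trans (NR_div_ge _ scale_neq0).
rewrite !NRM -expr2 2!exprMn -expRM_natr mulfVK//.
have -> : NR scale ^+ 2 * (h ^+ 2 * expR x) * NR scale =
  (NR scale * h) ^+ 2 * (NR scale * expR x) by ring.
rewrite ler_pM ?exprn_ge0 ?mulr_ge0 ?expR_ge0 ?(ltW h0) ?(ltW D0)//.
by rewrite lerXn2r ?nnegrE ?NR_ge0 ?mulr_ge0 ?(ltW h0).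
Qed.

(** Raising to the power [q] turns the comparison of p / q with a logarithm into one between
    integers. *)
Lemma le_of_pow_le (y : N) (T : R) (p q : nat) :
  NR y <= NR scale * expR (ln 2 * T) ->
  N.leb (N.mul (N.pow 2 (N.of_nat p)) (N.pow scale (N.of_nat q)))
        (N.pow y (N.of_nat q)) ->
  p%:R <= q%:R * T.
Proof.
move=> yT /leb_NR; rewrite NRM !NRX => h.
have Dq : 0 < NR scale ^+ q by rewrite exprn_gt0// scale_gt0.
have : 2 ^+ p * NR scale ^+ q <= expR (ln 2 * T) ^+ q * NR scale ^+ q.
  rewrite -exprMn; apply: (le_trans h); rewrite lerXn2r ?nnegrE ?NR_ge0//.
    by rewrite mulr_ge0 ?expR_ge0 ?NR_ge0.
  by rewrite mulrC.
rewrite ler_pM2r//.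
have -> : 2 ^+ p = expR (ln 2 * p%:R) :> R by rewrite expRM_natr lnK ?posrE.
by rewrite -expRM_natr ler_expR -mulrA ler_pM2l ?ln2_gt0// mulrC.
Qed.

Lemma ge_of_pow_ge (y : N) (T : R) (p q : nat) :
  NR scale * expR (ln 2 * T) <= NR y ->
  N.leb (N.pow y (N.of_nat q))
        (N.mul (N.pow 2 (N.of_nat p)) (N.pow scale (N.of_nat q))) ->
  q%:R * T <= p%:R.
Proof.
move=> yT /leb_NR; rewrite NRM !NRX => h.
have Dq : 0 < NR scale ^+ q by rewrite exprn_gt0// scale_gt0.
have : expR (ln 2 * T) ^+ q * NR scale ^+ q <= 2 ^+ p * NR scale ^+ q.
  rewrite -exprMn; apply: le_trans h; rewrite lerXn2r ?nnegrE ?NR_ge0//.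
    by rewrite mulr_ge0 ?expR_ge0 ?NR_ge0.
  by rewrite mulrC.
rewrite ler_pM2r//.
have -> : 2 ^+ p = expR (ln 2 * p%:R) :> R by rewrite expRM_natr lnK ?posrE.
by rewrite -expRM_natr ler_expR -mulrA ler_pM2l ?ln2_gt0// mulrC.
Qed.

(** Upper roundings of the two terms subtracted in [harm_dyadic_ge]. Later checks ensure that the
    subtraction in [block_floor] does not truncate. *)
Definition block_error (K : nat) : N :=
  N.add (N.add (harm_floor (2 ^ K).-1) (N.of_nat (2 ^ K).-1))
        (N.add (N.div scale (N.of_nat (2 ^ K.+1))) (Npos xH)).

Definition block_floor (K : nat) : N :=
  N.sub (harm_floor (2 ^ K.+1).-1) (block_error K).

(** After [K] summed entries, harmonic numbers are extrapolated by a lower bound for every later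
    dyadic block, which avoids exponentially long sums. *)
Definition lower_entries (K L : nat) : seq N :=
  let h := harm_floor (2 ^ K.+1).-1 in let b := block_floor K in
  [seq harm_floor (2 ^ i).-1 | i <- iota 2 K] ++
  [seq N.add h (N.mul (N.of_nat i) b) | i <- iota 1 L].

Definition upper_entries (K : nat) : seq N :=
  [seq N.add (harm_floor (2 ^ i).-1) (N.of_nat (2 ^ i).-1) | i <- iota 2 K].

(** Upper rounding of (h + 1)^2, which controls the rest of the series by [expR_cost_tail_le]. *)
Definition upper_base (K : nat) : N :=
  let b := N.add (N.add (harm_floor (2 ^ K).-1) (N.of_nat (2 ^ K).-1)) scale in
  N.add (N.div (N.mul b b) scale) (Npos xH).

Lemma block_floor_le K i :
  N.leb (block_error K) (harm_floor (2 ^ K.+1).-1) -> (K <= i)%N ->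
  NR (block_floor K) <= NR scale * (harm (2 ^ i.+1).-1 - harm (2 ^ i).-1).
Proof.
move=> /N.leb_le/N.sub_add eqb Ki; have D0 := scale_gt0.
have n0 : N.of_nat (2 ^ K.+1) <> N0.
  by move=> /(congr1 N.to_nat)/eqP; rewrite Nat2N.id expn_eq0.
have qge := NR_div_ge scale n0; rewrite NR_bin natrX in qge.
have dy := harm_dyadic_ge Ki; have h2 := harm_floor_le (2 ^ K.+1).-1.
have h1 := harm_floor_ge (2 ^ K).-1.
rewrite -eqb NRD {2}/block_error NRD [NR (N.add (N.div _ _) _)]NRD in h2.
rewrite (_ : NR (Npos xH) = 1)// -/(block_floor K) in h2.
have v0 : 0 <= (2 ^+ i.+1)^-1 :> R by rewrite invr_ge0 exprn_ge0.
rewrite -ler_pdivrMr ?exprn_gt0// in qge.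
have := ler_wpM2l (ltW D0) dy; have := mulr_ge0 (ltW D0) v0.
move: h1 h2 qge; rewrite !mulrBr.
set s := NR scale; set a := NR (N.add _ _); set b := NR (block_floor K).
set q := NR (N.div _ _); set v := s * (2 ^+ i.+1)^-1; set w := s / 2 ^+ K.+1.
lra.
Qed.

Lemma harm_lower_ge K m : N.leb (block_error K) (harm_floor (2 ^ K.+1).-1) ->
  NR (N.add (harm_floor (2 ^ K.+1).-1) (N.mul (N.of_nat m) (block_floor K))) <=
  NR scale * harm (2 ^ (K.+1 + m)).-1.
Proof.
move=> chk; elim: m => [|m IH].
  by rewrite N.mul_0_l N.add_0_r addn0 harm_floor_le.
have := block_floor_le chk (leq_trans (leqnSn K) (leq_addr m K.+1)); move: IH.
rewrite addnS !NRD !NRM !NR_bin -[m.+1%:R]natr1 mulrDl mul1r mulrBr.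
set a := NR _; set b := _ * NR _; set c := NR (block_floor K); lra.
Qed.

Lemma alpha_ge (K L p q : nat) : (0 < q)%N ->
  N.leb (block_error K) (harm_floor (2 ^ K.+1).-1) ->
  N.leb (N.mul (N.pow 2 (N.of_nat p)) (N.pow scale (N.of_nat q)))
        (N.pow (foldr sqrt_step scale (lower_entries K L)) (N.of_nat q)) ->
  p%:R <= q%:R * (4 * (alpha R - 1)).
Proof.
move=> q0 chk; have q0R : 0 < q%:R :> R by rewrite ltr0n.
move=> chk2; suff h0 : NR (foldr sqrt_step scale (lower_entries K L)) <=
    NR scale * expR (ln 2 * cost_tail 2 (size (lower_entries K L))).
  apply: (le_trans (le_of_pow_le h0 chk2)); rewrite ler_wpM2l//.
  have := @balanced_defect1_le R (size (lower_entries K L)).+2.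
  by rewrite balanced_defectE; lra.
apply: foldr_sqrt_step_le => j; rewrite /lower_entries nth_cat size_cat !size_map !size_iota => jKL.
case: ltnP => jK.
  by rewrite (nth_map 0%N) ?size_iota// nth_iota// harm_floor_le.
have jL : (j - K < L)%N by rewrite ltn_subLR.
rewrite (nth_map 0%N) ?size_iota// nth_iota//.
have -> : (2 + j = K.+1 + (1 + (j - K)))%N by rewrite -[in LHS](subnKC jK); lia.
exact: harm_lower_ge.
Qed.

Lemma alpha_le_check (K p q : nat) : (0 < q)%N ->
  N.leb (N.pow (foldr sqrt_step_up (upper_base K.+2) (upper_entries K)) (N.of_nat q))
        (N.mul (N.pow 2 (N.of_nat p)) (N.pow scale (N.of_nat q))) ->
  q%:R * (4 * (alpha R - 1)) <= p%:R.
Proof.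
move=> q0 chk; have q0R : 0 < q%:R :> R by rewrite ltr0n.
have D0 := scale_gt0.
suff h : alpha R - 1 <= p%:R / q%:R / 4.
  by rewrite mulrC -ler_pdivlMr// mulrC -ler_pdivlMr.
apply: alpha_le => n.
have sK : size (upper_entries K) = K by rewrite size_map size_iota.
apply: (le_trans (@balanced_defect_homo R 1 isT n (K + n).+2 _)).
  by rewrite -addn2 addnAC leq_addl.
rewrite balanced_defectE ler_pM2r ?invr_gt0// ler_pdivlMr// mulrC.
apply: ge_of_pow_ge chk; rewrite -{1}sK.
apply: foldr_sqrt_step_up_ge => [j|].
  rewrite sK => jK.
  by rewrite (nth_map 0%N) ?size_iota// nth_iota// harm_floor_ge.
rewrite sK addn2 /upper_base.
have := harm_floor_ge (2 ^ K.+2).-1; set b := N.add (harm_floor _) _ => hb.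
apply: (@le_trans _ _ (NR scale * (harm (2 ^ K.+2).-1 + 1) ^+ 2)).
  by rewrite ler_wpM2l ?(ltW D0)// expR_cost_tail_le.
rewrite NRD (_ : NR (Npos xH) = 1)// -(ler_pM2r D0).
apply: le_trans (NR_div_ge _ scale_neq0); rewrite NRM NRD.
set s := NR scale in D0 hb *; set h := harm _ in hb *.
have -> : s * (h + 1) ^+ 2 * s = (s * h + s) * (s * h + s) by ring.
have sh : 0 <= s * h + s by rewrite addr_ge0 ?mulr_ge0 ?(ltW D0)// harm_ge0.
by rewrite ler_pM// lerD2r.
Qed.

End FixedPoint.

Definition numeric_scale : N := 33554432%num.

(** The target 637 / 250 = 4 * 0.637 bounds 4 * (alpha - 1) from below; the companion check uses 51
    / 20 = 4 * 0.6375 from above. *)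
Lemma alpha_lower_check :
  N.leb (block_error numeric_scale 9) (harm_floor numeric_scale (2 ^ 10).-1) &&
  N.leb (N.mul (N.pow 2 (N.of_nat 637)) (N.pow numeric_scale (N.of_nat 250)))
        (N.pow (foldr (sqrt_step numeric_scale) numeric_scale
                  (lower_entries numeric_scale 9 16)) (N.of_nat 250)).
Proof. by vm_compute. Qed.

Lemma alpha_upper_check :
  N.leb (N.pow (foldr (sqrt_step_up numeric_scale) (upper_base numeric_scale 9)
                  (upper_entries numeric_scale 7)) (N.of_nat 20))
        (N.mul (N.pow 2 (N.of_nat 51)) (N.pow numeric_scale (N.of_nat 20))).
Proof. by vm_compute. Qed.

End NumericalBounds.

Lemma alpha_bounds (R : realType) :
  1637%:R / 1000%:R <= alpha R < (1638%:R / 1000%:R : R).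
Proof.
have s0 : numeric_scale <> N0 by [].
have /andP[c1 c2] := alpha_lower_check.
have lo := @alpha_ge R _ s0 9 16 637 250 isT c1 c2.
have hi := @alpha_le_check R _ s0 7 51 20 isT alpha_upper_check.
move=> {c1 c2}.
have e637 : 637%:R = 6 * 10 ^+ 2 + 3 * 10 + 7 :> R.
  by rewrite -natrX -!natrM -!natrD.
have e250 : 250%:R = 2 * 10 ^+ 2 + 5 * 10 :> R.
  by rewrite -natrX -!natrM -!natrD.
have -> : 1637%:R = 10 ^+ 3 + 637%:R :> R by rewrite -natrX -!natrD.
have -> : 1638%:R = 10 ^+ 3 + 637%:R + 1%:R :> R.
  by rewrite -natrX -!natrD.
have -> : 1000%:R = 10 ^+ 3 :> R by rewrite -natrX.
have p10 : 0 < 10 ^+ 3 :> R by rewrite exprn_gt0.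
move: (alpha R) lo hi => a; rewrite e637 e250 => lo hi; apply/andP; split.
  by rewrite (ler_pdivrMr _ _ p10); lra.
by rewrite (ltr_pdivlMr _ _ p10); lra.
Qed.

(** * Convergence in probability *)

Section Whp.
Context {R : realType}.
Local Notation E := (@Etree R).

(** Union bound over the two tails, then a squeeze as ln n tends to infinity. *)
Lemma whp_log2_betweenP (X : bintree -> nat) (a b : R) :
  (forall eps : R, 0 < eps -> exists A : R, forall n, (2 <= n)%N ->
     E n (fun t => ((X t)%:R < (a - eps) * log2 n%:R)%R%:R) <= A / ln n%:R) ->
  (forall eps : R, 0 < eps -> exists A : R, forall n, (2 <= n)%N ->
     E n (fun t => ((b + eps) * log2 n%:R < (X t)%:R)%R%:R) <= A / ln n%:R) ->
  whp_log2_between X a b.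
Proof.
move=> lo hi eps eps0; have [A hA] := lo _ eps0; have [B hB] := hi _ eps0.
have ln_pinfty : (ln (n%:R : R) @[n --> \oo] --> +oo)%classic.
  apply/cvgryPge => M; near=> n; rewrite -[M]expRK ler_ln ?posrE ?expR_gt0//.
    by near: n; exact: nbhs_infty_ger.
  by rewrite ltr0n; near: n; exact: nbhs_infty_gt.
have to1 : ((1 - (A + B) / ln (n%:R : R)) @[n --> \oo] --> (1 : R))%classic.
  rewrite -[X in (_ --> X)%classic]subr0; apply: cvgB; first exact: cvg_cst.
  rewrite -[X in (_ --> X)%classic](mulr0 (A + B)); apply: cvgMr.
  apply/gtr0_cvgV0 => //; exists 2%N => // n /= n2.
  by rewrite ln_gt0// ltr1n.
apply: (@squeeze_cvgr _ _ _ _ (fun n : nat => 1 - (A + B) / ln n%:R) (fun=> 1)) => //;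
  last exact: cvg_cst.
near=> n; have n2 : (2 <= n)%N by near: n; exact: nbhs_infty_ge.
have n1 : (0 < n)%N by exact: ltnW.
rewrite Pr_dtcsE; apply/andP; split; last first.
  rewrite -[leRHS](Etree_cst n); apply: le_Etree => // t _.
  by case: (_ && _).
have := hA n n2; have := hB n n2; set f := fun t => _; set g := fun t => _ => fB gA.
have : E n (fun=> 1) <= E n (fun t =>
    ((a - eps) * log2 n%:R <= (X t)%:R <= (b + eps) * log2 n%:R)%R%:R
    + (f t + g t)).
  apply: le_Etree => // t _; rewrite /f /g.
  by case: leP => _; case: leP => _ /=; rewrite ?addr0 ?add0r ?lerDl ?lerDr.
rewrite !EtreeD Etree_cst mulrDl; lra.
Unshelve. all: by end_near.
Qed.

End Whp.

Theorem theorem1p2 (R : realType) :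
  [/\ 1637%:R / 1000%:R <= alpha R < 1638%:R / 1000%:R,
      whp_log2_between R_ord (1 / alpha R) (2%:R / alpha R)
    & whp_log2_between R_unord (1 / alpha R) (2%:R / (alpha R - 1))].
Proof.
have /andP[lo hi] := alpha_bounds R.
have k0 : 0 < 1000%:R :> R by rewrite ltr0n.
have a0 : 0 < alpha R - 1.
  rewrite subr_gt0; apply: lt_le_trans lo.
  by rewrite (ltr_pdivlMr _ _ k0) mul1r ltr_nat.
have a1 : 0 < alpha R by apply: lt_trans ltr01 _; rewrite -subr_gt0.
have l2 := @ln2_gt0 R.
split; first by rewrite lo hi.
- apply: whp_log2_betweenP => eps eps0.
    by apply: Pr_largest_repeat_lt => // t; exact: eqxx.
  (* With kappa = alpha * ln 2 the threshold 2 ln 2 / kappa is 2 / alpha. *)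
  have := Pr_largest_repeat_gt eq_op_leaves (mulr_gt0 a1 l2) Pr_shape_le eps0.
  by rewrite -mulf_div divff ?mulr1// gt_eqF.
- apply: whp_log2_betweenP => eps eps0.
    by apply: Pr_largest_repeat_lt => //; exact: unordered_iso_refl.
  have := Pr_largest_repeat_gt unordered_iso_leaves (mulr_gt0 a0 l2) Pr_unordered_shape_le eps0.
  by rewrite -mulf_div divff ?mulr1// gt_eqF.
Qed.
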